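(* Let $p:\mathbb{R}^n\to\mathbb{R}$ be a homogeneous polynomial that is hyperbolic along $e\in\mathbb{R}^n$, with $d:=\deg p\ge 4$, and let $\Lambda_+=\Lambda_+(p,e)$ be its hyperbolicity cone, with $\dim\Lambda_+\ge 3$. Suppose that $\Lambda_+$ is regular and rank-one generated (ROG) with respect to $p$. Then for every $k$ with $1\le k\le d-3$, $$\operatorname{Aut}(\Lambda_+^{(k)})=\{A\in\operatorname{Aut}(\Lambda_+)\mid A(\mathbb{R}_+e)=\mathbb{R}_+e\},$$ where $\Lambda_+^{(k)}=\Lambda_+(D_e^kp,e)$ is the $k$-th derivative relaxation of $\Lambda_+$ with respect to $e$.
   Context: A homogeneous polynomial $p:\mathbb{R}^n\to\mathbb{R}$ of degree $d$ is hyperbolic along $e\in\mathbb{R}^n$ if $p(e)>0$ and for every $x\in\mathbb{R}^n$ the univariate polynomial $t\mapsto p(x-te)$ has only real roots. Its hyperbolicity cone is the closed convex cone $\Lambda_+(p,e)=\{x\in\mathbb{R}^n\mid \text{all roots of } t\mapsto p(te-x) \text{ are nonnegative}\}$. The eigenvalues of $x$ are the $d$ roots of $t\mapsto p(te-x)$ counted with multiplicity; for $x\in\Lambda_+(p,e)$, $\operatorname{rank}(x)$ is the number of nonzero eigenvalues of $x$ (counted with multiplicity). $D_e^kp(x)=\frac{d^k}{dt^k}p(x+te)|_{t=0}$, which is again hyperbolic along $e$ and has degree $d-k$. A closed convex cone $K\subseteq\mathbb{R}^n$ is pointed if $K\cap(-K)=\{0\}$, and regular if it is pointed and $\dim K=n$.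 A face of $K$ is a nonempty convex cone $F\subseteq K$ such that $x,y\in K$, $x+y\in F$ imply $x,y\in F$; an extreme ray is a face of dimension $1$. A pointed hyperbolicity cone $\Lambda_+=\Lambda_+(p,e)$ is rank-one generated (ROG) with respect to $p$ (and $e$) if every extreme ray of $\Lambda_+$ is generated by an element of rank $1$ (rank computed with respect to $p$ and $e$). $\operatorname{Aut}(K)=\{A\in \mathrm{GL}_n(\mathbb{R})\mid AK=K\}$, and $\mathbb{R}_+e=\{\alpha e\mid\alpha\ge 0\}$. *)

(* Defs.v *)
From mathcomp Require Import all_boot all_order all_algebra.
From mathcomp Require Import boolp classical_sets reals.
From mathcomp Require Import mpoly complex polyrcf.

Set Implicit Arguments.
Unset Strict Implicit.
Unset Printing Implicit Defensive.

Import Order.TTheory GRing.Theory Num.Theory.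

Local Open Scope ring_scope.
Local Open Scope classical_set_scope.

(* Vectors of R^n are columns, so that A : 'M[R]_n acts by x |-> A *m x. *)

Section ConvexCones.
Context {R : realType} {n : nat}.
Implicit Types (K F : set 'cV[R]_n) (x : 'cV[R]_n) (A : 'M[R]_n).

(* The linear span of an arbitrary set of vectors; fullv is only a default,
   never used by linear_hullP. *)
Definition linear_hull K : {vspace 'cV[R]_n} :=
  xget fullv [set V : {vspace 'cV[R]_n} |
    K `<=` [set x | x \in V] /\
    forall W : {vspace 'cV[R]_n}, K `<=` [set x | x \in W] -> (V <= W)%VS].

Lemma linear_hullP K :
  K `<=` [set x | x \in linear_hull K] /\
  forall W : {vspace 'cV[R]_n},
    K `<=` [set x | x \in W] -> (linear_hull K <= W)%VS.
Proof.
rewrite /linear_hull; case: xgetP => [V _ //|noV]; exfalso.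
pose P k := `[< exists V : {vspace 'cV[R]_n},
  K `<=` [set x | x \in V] /\ \dim V = k >].
have exP : exists k, P k.
  by exists (\dim {: 'cV[R]_n}); apply/asboolP; exists fullv; split=> // x _;
     exact: memvf.
case: (ex_minnP exP) => k /asboolP[V [KV dV]] min_k.
apply: (noV V); split=> // W KW.
have KVW : K `<=` [set x | x \in (V :&: W)%VS].
  by move=> x Kx /=; rewrite memv_cap KV // KW.
have le_dim : (\dim V <= \dim (V :&: W))%N.
  by rewrite dV; apply: min_k; apply/asboolP; exists (V :&: W)%VS.
have /eqP <- : (V :&: W)%VS == V by rewrite eqEdim capvSl.
exact: capvSr.
Qed.

(* All cones below contain 0, so the dimension of the affine hull is that of
   the linear span. *)
Definition cone_dim K : nat := \dim (linear_hull K).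

Definition convex_cone K : Prop :=
  K !=set0 /\
  forall x y (a b : R),
    0 <= a -> 0 <= b -> K x -> K y -> K (a *: x + b *: y).

Definition pointed K : Prop := K `&` [set - x | x in K] = [set 0].

Definition regular K : Prop := pointed K /\ cone_dim K = n.

Definition face K F : Prop :=
  [/\ convex_cone F, F `<=` K &
      forall x y, K x -> K y -> F (x + y) -> F x /\ F y].

Definition extreme_ray K F : Prop := face K F /\ cone_dim F = 1%N.

Definition ray x : set 'cV[R]_n := [set a *: x | a in [set a : R | 0 <= a]].

Definition Aut K : set 'M[R]_n :=
  [set A | A \in unitmx /\ mulmx A @` K = K].

End ConvexCones.

Section Hyperbolic.
Context {R : realType} {n : nat}.
Implicit Types (p : {mpoly R[n]}) (x v e : 'cV[R]_n).

(* The univariate polynomial t |-> p(x + t v). *)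
Definition line_poly p x v : {poly R} :=
  mmap polyC (fun i => (x i 0)%:P + v i 0 *: 'X) p.

Lemma horner_line_poly p x v t :
  (line_poly p x v).[t] = p.@[fun i => (x + t *: v) i 0].
Proof.
rewrite /line_poly /meval /mmap horner_sum; apply: eq_bigr => m _.
rewrite hornerM hornerC /mmap1 horner_prod; congr (_ * _).
by apply: eq_bigr => i _; rewrite horner_exp !hornerE !mxE [v i 0 * t]mulrC.
Qed.

(* "Only real roots" refers to the roots in the complex numbers R[i]. *)
Definition real_rooted (q : {poly R}) : Prop :=
  forall z : R[i], root (map_poly (real_complex R) q) z -> complex.Im z = 0.

Definition hyperbolic p e : Prop :=
  0 < p.@[fun i => e i 0] /\ forall x, real_rooted (line_poly p x (- e)).

(* Real roots suffice here: when p is hyperbolic along e, p(t e - x) has no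
   other roots. *)
Definition hyp_cone p e : set 'cV[R]_n :=
  [set x | forall t : R, root (line_poly p (- x) e) t -> 0 <= t].

(* The real roots of t |-> p(t e - x), repeated according to multiplicity;
   these are all its roots when p is hyperbolic along e. *)
Definition eigenvalues p e x : seq R :=
  let q := line_poly p (- x) e in
  flatten [seq nseq (mup a q) a | a <- rootsR q].

Definition hyp_rank p e x : nat :=
  count (fun a => a != 0) (eigenvalues p e x).

Definition ROG p e : Prop :=
  pointed (hyp_cone p e) /\
  forall F, extreme_ray (hyp_cone p e) F ->
    exists x, [/\ hyp_cone p e x, hyp_rank p e x = 1%N & F = ray x].

(* D_e^k p as an element of {mpoly R[n]}: the k-th derivative at t = 0 of
   p(X + t e), viewed as a polynomial in t with coefficients in
   {mpoly R[n]}. *)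
Definition dir_deriv e k p : {mpoly R[n]} :=
  ((mmap (polyC \o @mpolyC n R)
         (fun i => ('X_i)%:P + (e i 0)%:MP *: 'X) p)^`(k)).[0].

Lemma meval_dir_deriv e k p x :
  (dir_deriv e k p).@[fun i => x i 0] = ((line_poly p x e)^`(k)).[0].
Proof.
rewrite /dir_deriv -horner_map rmorph0 -derivn_map; congr (_^`(_).[_]).
rewrite /line_poly /mmap rmorph_sum /=; apply: eq_bigr => m _.
rewrite rmorphM /= map_polyC /= mevalC /mmap1 rmorph_prod /=.
congr (_ * _); apply: eq_bigr => i _.
rewrite rmorphXn rmorphD /= map_polyC /= -mul_polyC rmorphM /= map_polyC.
by rewrite map_polyX /= mevalXU mevalC mul_polyC.
Qed.

End Hyperbolic.

(* Main.v *)
From HB Require Import structures.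
Require Import Defs.
From mathcomp Require Import all_boot all_order all_algebra.
From mathcomp Require Import boolp classical_sets reals.
From mathcomp Require Import mpoly complex polyrcf.
From mathcomp Require Import ring lra zify.

(** Let [h] be the [k]-th derivative of [p] along [e], let [L] be the
    hyperbolicity cone of [p] and [K], which contains [L], that of [h].

    The main point is that [K] remembers [L]: the extremal rays of [L] are
    exactly the extremal rays of [K] at which the boundary of [K] is not smooth
    ([extremal_nonsmoothP]). At a nonsmooth point of [K] zero is a multiple
    eigenvalue for [h], and by Rolle's theorem such points lie in [L]
    ([cone_of_iter]). Conversely, by the ROG hypothesis an extremal [x] of [L]
    has rank one, which means that [p], and therefore each of its derivatives,
    is affine along every line of direction [x] ([affine_along_cone],
    [rank1_affine]); as [h] has degree at least three, this forces [x] to be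
    extremal in [K], and if [K] were smooth at [x], the quadratic form
    [D_x D_e^(d-3) p] would be nonnegative and invariant under translation by
    all extremal elements of [L], hence zero, which contradicts pointedness.
    Since [L] is generated by its extremal rays ([extremal_generate]), every
    automorphism of [K] is an automorphism of [L].

    Next, a polynomial that cuts out a cone and is affine along directions
    generating [L] is determined by the cone up to a constant factor, because
    along such a direction it is an affine function whose zero is the point where
    the line leaves the cone ([affine_proportional]). So an automorphism [A] of
    [L] satisfies [p (A y) = c * p y], and one of [K] moreover satisfies
    [h (A y) = c' * h y]. With [f = A^-1 e], comparing the two shows that the
    [k]-th derivatives of [p] along [f] and along [e] are proportional. This is
    the equality case of the inequality between the arithmetic and the harmonic
    mean of the eigenvalues of [f] for a derivative of [p] of degree [k + 1];
    these eigenvalues are thus all equal and [f] is a multiple of [e]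
    ([iter_dirD_direction]). The other inclusion follows from
    [p (A y) = c * p y] alone.

    All this rests on the convexity of hyperbolicity cones, proved after Garding
    by following complex roots along a homotopy ([root_homotopy],
    [garding_add]), and on the nonnegativity on the cone of iterated derivatives
    along its elements ([mixed_deriv_ge0]), which comes from the Gauss-Lucas
    theorem. *)

Set Implicit Arguments.
Unset Strict Implicit.
Unset Printing Implicit Defensive.

Import Order.TTheory GRing.Theory Num.Theory.

Local Open Scope ring_scope.
Local Open Scope classical_set_scope.

Local Notation normc := Normc.normc.
Local Notation toC R := (real_complex R).
Local Notation Re := complex.Re.
Local Notation Im := complex.Im.

(** * Directional derivatives and restrictions to lines *)

Section PolynomialInduction.
Context {R : comNzRingType} {n : nat}.

Lemma mpoly_ring_ind (P : {mpoly R[n]} -> Prop) :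
  (forall c, P c%:MP) -> (forall i, P 'X_i) ->
  (forall p q, P p -> P q -> P (p + q)) ->
  (forall p q, P p -> P q -> P (p * q)) -> forall p, P p.
Proof.
move=> PC PX PD PM p; rewrite (mpolyE p).
have P0 : P 0 by have := PC 0; rewrite mpolyC0.
have P1 : P 1 by have := PC 1; rewrite mpolyC1.
apply: (big_ind P) => // m _; rewrite -mul_mpolyC; apply: (PM) => //.
rewrite mpolyXE_id; apply: (big_ind P) => [//|x y Px Py|i _]; first exact: PM.
by move: (m i : nat) => k; elim: k => [|k IH]; rewrite ?expr0 // exprS; exact: PM.
Qed.

(** Graded induction: a property indexed by the degree only has to be
    checked on constants and variables. *)
Lemma dhomog_ind (P : nat -> {mpoly R[n]} -> Prop) :
  (forall d, P d 0) -> (forall c, P 0%N c%:MP) -> (forall i, P 1%N 'X_i) ->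
  (forall d p q, P d p -> P d q -> P d (p + q)) ->
  (forall d1 d2 p q, P d1 p -> P d2 q -> P (d1 + d2)%N (p * q)) ->
  forall d p, p \is d.-homog -> P d p.
Proof.
move=> P0 PC PX PD PM d p hp; rewrite (mpolyE p) big_seq.
apply: (big_ind (P d)) => // [|m mp]; first exact: PD.
rewrite -mul_mpolyC -[d]add0n; apply: (PM) => //.
have <- : mdeg m = d by move/dhomogP: hp => /(_ _ mp).
rewrite mdegE mpolyXE_id.
apply: (big_ind2 P) => //.
- by have := PC 1; rewrite mpolyC1.
- by move=> *; exact: PM.
move=> i _; move: (m i : nat) => k; elim: k => [|k IH]; first by have := PC 1; rewrite mpolyC1.
by rewrite exprS -add1n; exact: PM.
Qed.

End PolynomialInduction.

Definition dirD {R : comNzRingType} {n : nat} (v : 'cV[R]_n) (p : {mpoly R[n]}) :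
  {mpoly R[n]} := \sum_(i < n) v i 0 *: p^`M(i).

Section DirectionalDerivative.
Context {R : comNzRingType} {n : nat}.
Implicit Types (p q : {mpoly R[n]}) (u v : 'cV[R]_n).

Lemma dirD_is_linear v : linear (dirD v : {mpoly R[n]} -> _).
Proof.
move=> c p q; rewrite /dirD scaler_sumr -big_split /=; apply: eq_bigr => i _.
by rewrite mderivD mderivZ scalerDr !scalerA mulrC.
Qed.

HB.instance Definition _ v :=
  GRing.isLinear.Build R {mpoly R[n]} {mpoly R[n]} _ (dirD v) (dirD_is_linear v).

Lemma dirDM v p q : dirD v (p * q) = dirD v p * q + p * dirD v q.
Proof.
rewrite /dirD mulr_suml mulr_sumr -big_split /=; apply: eq_bigr => i _.
by rewrite mderivM scalerDr -scalerAl -scalerAr.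
Qed.

Lemma dirDC v c : dirD v (c%:MP : {mpoly R[n]}) = 0.
Proof. by rewrite /dirD big1 // => i _; rewrite mderivC scaler0. Qed.

Lemma dirDX v i : dirD v ('X_i : {mpoly R[n]}) = (v i 0)%:MP.
Proof.
rewrite /dirD (bigD1 i) //= big1 => [|j ji].
  by rewrite addr0 mderivX mnm1E eqxx scale1r -{1}[U_(i)%MM]add0m addmK mpolyX0 alg_mpolyC.
by rewrite mderivX mnm1E eq_sym (negbTE ji) scale0r scaler0.
Qed.

Lemma dirD_comm u v p : dirD u (dirD v p) = dirD v (dirD u p).
Proof.
have E w i : (dirD w p)^`M(i) = dirD w p^`M(i).
  rewrite /dirD linear_sum; apply: eq_bigr => j _ /=.
  by rewrite mderivZ mderiv_comm.
rewrite {1}/dirD [RHS]/dirD.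
under eq_bigr do rewrite E /dirD scaler_sumr.
under [RHS]eq_bigr do rewrite E /dirD scaler_sumr.
rewrite exchange_big; apply: eq_bigr => i _; apply: eq_bigr => j _ /=.
by rewrite !scalerA mulrC mderiv_comm.
Qed.

Lemma dirD_lin a b u v p :
  dirD (a *: u + b *: v) p = a *: dirD u p + b *: dirD v p.
Proof.
rewrite /dirD !scaler_sumr -big_split; apply: eq_bigr => i _ /=.
by rewrite !mxE scalerDl !scalerA.
Qed.

Lemma dirDD u v p : dirD (u + v) p = dirD u p + dirD v p.
Proof. by have := dirD_lin 1 1 u v p; rewrite !scale1r. Qed.

Lemma dirDZ a u p : dirD (a *: u) p = a *: dirD u p.
Proof. by have := dirD_lin a 0 u 0 p; rewrite !scale0r !addr0. Qed.

Lemma dirD_homog d p v : p \is d.+1.-homog -> dirD v p \is d.-homog.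
Proof.
move=> hp; apply: rpred_sum => i _; apply: rpredZ.
apply/dhomogP => m; rewrite mcoeff_msupp mcoeff_mderiv => nz.
have : (m + U_(i))%MM \in msupp p.
  by rewrite mcoeff_msupp; apply: contraNneq nz => ->; rewrite mul0rn.
by move=> mp; move/dhomogP: hp => /(_ _ mp) /=; rewrite mdegD mdeg1 addn1 => -[].
Qed.

Lemma dirD_homog0 p v : p \is 0.-homog -> dirD v p = 0.
Proof.
move=> hp; suff -> : p = (p@_0)%:MP by exact: dirDC.
apply/mpolyP => m; rewrite mcoeffC; case: eqVneq => [<-|m0].
  by rewrite mulr1.
rewrite mulr0; apply/eqP/negPn/negP => nz.
move/dhomogP: hp => /(_ m); rewrite mcoeff_msupp nz => /(_ isT) /= /eqP.
by rewrite mdeg_eq0 (negbTE m0).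
Qed.

Lemma iter_dirD_homog k d p v :
  p \is (d + k).-homog -> iter k (dirD v) p \is d.-homog.
Proof.
elim: k d => [|k IH] d hp; first by rewrite addn0 in hp.
by rewrite iterS; apply: dirD_homog; apply: IH; rewrite addSnnS.
Qed.

Lemma iter_dirD_comm k u v p :
  iter k (dirD u) (dirD v p) = dirD v (iter k (dirD u) p).
Proof. by elim: k => //= k ->; rewrite dirD_comm. Qed.

Lemma iter_dirD_iter_comm j k u v p :
  iter k (dirD u) (iter j (dirD v) p) = iter j (dirD v) (iter k (dirD u) p).
Proof. by elim: j => [//|j IH]; rewrite (iterS j) iter_dirD_comm IH. Qed.

End DirectionalDerivative.

(** The points may have coordinates in any extension [S] of the coefficient
    ring, so that real and complex lines are treated at once; [line_poly] is
    the case where [h] is the identity. *)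
Definition gline {R S : comNzRingType} {n : nat} (h : R -> S)
    (p : {mpoly R[n]}) (w c : 'I_n -> S) : {poly S} :=
  mmap (polyC \o h) (fun i => (w i)%:P + c i *: 'X) p.

Section Lines.
Context {R S : comNzRingType} {n : nat} (h : {rmorphism R -> S}).
Implicit Types (p q : {mpoly R[n]}) (w c : 'I_n -> S).

Lemma horner_gline p w c z :
  (gline h p w c).[z] = mmap h (fun i => w i + z * c i) p.
Proof.
rewrite /gline /mmap horner_sum; apply: eq_bigr => m _.
rewrite hornerM hornerC /mmap1 horner_prod; congr (_ * _).
by apply: eq_bigr => i _; rewrite horner_exp !hornerE mulrC.
Qed.

Lemma deriv_gline p w (v : 'cV[R]_n) :
  (gline h p w (fun i => h (v i 0)))^`() =
    gline h (dirD v p) w (fun i => h (v i 0)).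
Proof.
rewrite /gline; set g := fun i => _.
move: p; apply: mpoly_ring_ind => [c|i|p q IHp IHq|p q IHp IHq].
- by rewrite dirDC mmap0 mmapC /= derivC.
- by rewrite dirDX mmapC mmapX mmap1U /g derivD derivC add0r derivZ derivX alg_polyC.
- by rewrite [dirD _ _]linearD /= !mmapD derivD IHp IHq.
- rewrite dirDM mmapD !(mmap_is_multiplicative _ _).1.
  by rewrite derivM IHp IHq.
Qed.

Lemma mmap_homog d p w a :
  p \is d.-homog -> mmap h (fun i => a * w i) p = a ^+ d * mmap h w p.
Proof.
move: d p; apply: dhomog_ind => [d|c|i|d p q Hp Hq|d1 d2 p q Hp Hq].
- by rewrite !mmap0 mulr0.
- by rewrite !mmapC expr0 mul1r.
- by rewrite !mmapX !mmap1U expr1.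
- by rewrite !mmapD Hp Hq mulrDr.
- rewrite !(mmap_is_multiplicative _ _).1 Hp Hq exprD; ring.
Qed.

End Lines.

(** * Univariate polynomials *)

Section RootCounting.
Context {F : numFieldType}.
Implicit Types (q r : {poly F}).

Lemma poly_eq0_nat q (c : F) : (forall k : nat, q.[c + k%:R] = 0) -> q = 0.
Proof.
move=> h; apply/eqP/negPn/negP => q0.
pose rs := [seq c + k%:R | k <- iota 0 (size q)].
have := max_poly_roots (rs := rs) q0.
rewrite size_map size_iota ltnn => H; apply: notF; apply: H.
  by apply/allP => x /mapP[k _ ->]; apply/rootP.
rewrite map_inj_uniq ?iota_uniq // => i j /addrI /eqP.
by rewrite eqr_nat => /eqP.
Qed.

Lemma poly_eq_neq0 q r : (forall z, z != 0 -> q.[z] = r.[z]) -> q = r.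
Proof.
move=> h; apply/eqP; rewrite -subr_eq0; apply/eqP/(@poly_eq0_nat _ 1) => k.
by rewrite !hornerE h ?subrr // addrC natr1 pnatr_eq0.
Qed.

(** Both sides are the two dehomogenisations of one binary form of degree
    [d]. *)
Lemma coef_reverse d q r :
  (forall z, z != 0 -> q.[z] = z ^+ d * r.[z^-1]) ->
  forall j, q`_j = if (j <= d)%N then r`_(d - j) else 0.
Proof.
move=> h j; set N := size r.
have E : 'X^N * q = 'X^d * \sum_(i < N) r`_i *: 'X^(N - i).
  apply: poly_eq_neq0 => z z0; rewrite !hornerM !hornerXn h // horner_sum.
  rewrite mulrCA; congr (_ * _).
  rewrite [in LHS](@horner_coef_wide _ N) // mulr_sumr; apply: eq_bigr => i _.
  rewrite hornerZ hornerXn mulrCA; congr (_ * _).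
  have iN : (i <= N)%N by apply: ltnW.
  by rewrite exprVn -expfB // ?subKn.
have := congr1 (fun s : {poly F} => s`_(N + j)) E.
rewrite coefXnM ltnNge leq_addr /= addKn => ->.
rewrite coefXnM coef_sum.
case: ltnP => [lt_d|le_d].
  have [jd Nd] : (j <= d)%N /\ (N <= d - j)%N by lia.
  by rewrite jd nth_default.
have H (i : 'I_N) : (r`_i *: 'X^(N - i))`_(N + j - d) =
    if (i + j == d)%N then r`_i else 0 :> F.
  rewrite coefZ coefXn.
  have -> : (N + j - d == N - i)%N = (i + j == d)%N.
    have iN := ltn_ord i; apply/eqP/eqP => ?; lia.
  by case: ifP; rewrite ?mulr1 ?mulr0.
rewrite (eq_bigr _ (fun i _ => H i)); case: (leqP j d) => jd; last first.
  by rewrite big1 // => i _; case: ifP => // /eqP; lia.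
case: (ltnP (d - j) N) => dj.
  rewrite (bigD1 (Ordinal dj)) //= subnK // eqxx big1 ?addr0 // => i ne.
  case: ifP => // /eqP ij; case/negP: ne; apply/eqP/val_inj => /=; lia.
rewrite nth_default // big1 // => i _; case: ifP => // /eqP.
by have := ltn_ord i; lia.
Qed.

Lemma size_reverse d q r :
  (forall z, z != 0 -> q.[z] = z ^+ d * r.[z^-1]) -> (size q <= d.+1)%N.
Proof.
move=> h; apply/leq_sizeP => j jd; rewrite (coef_reverse h) ifN //.
by rewrite -ltnNge.
Qed.

End RootCounting.

Section RealPolynomials.
Context {R : rcfType}.
Implicit Types (q : {poly R}).

Lemma poly_eq0_ge q (c : R) : (forall t, c <= t -> q.[t] = 0) -> q = 0.
Proof. by move=> h; apply: (@poly_eq0_nat _ _ c) => k; rewrite h // lerDl. Qed.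

Lemma horner0_ge0 q : (forall t, 0 < t -> 0 <= q.[t]) -> 0 <= q.[0].
Proof.
move=> h; rewrite leNgt; apply/negP => q0.
have [|d d0 /(_ (d / 2))] := @poly_cont _ 0 q (- q.[0]); first by rewrite oppr_gt0.
rewrite subr0 gtr0_norm ?divr_gt0 // ltr_pdivrMr // mulr_natr mulr2n.
rewrite ltrDl d0 => /(_ isT); rewrite ltr_norml => /andP[_].
by have := h (d / 2); rewrite divr_gt0 // => /(_ isT); lra.
Qed.

Lemma horner0_gt0_near q : 0 < q.[0] ->
  exists2 d, 0 < d & forall t, `|t| < d -> 0 < q.[t].
Proof.
move=> q0; have [d d0 h] := @poly_cont _ 0 q _ q0; exists d => // t td.
by have := h t; rewrite subr0 td => /(_ isT); rewrite ltr_norml => /andP[]; lra.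
Qed.

Lemma horner_deriv0_gt0_near q : 0 <= q.[0] -> 0 < q^`().[0] ->
  exists2 d, 0 < d & forall t, 0 < t < d -> 0 < q.[t].
Proof.
move=> q0 dq0; have /factor_theorem[r Er] : root (q - q.[0]%:P) 0.
  by rewrite rootE !hornerE subrr.
have Eq : q = r * 'X + q.[0]%:P.
  by apply/eqP; rewrite -subr_eq Er subr0.
have r0 : 0 < r.[0] by move: dq0; rewrite Eq !derivE !hornerE; lra.
have [d d0 h] := horner0_gt0_near r0; exists d => // t /andP[t0 td].
by rewrite Eq !hornerE ltr_pwDl ?mulr_gt0 ?h ?gtr0_norm.
Qed.

Lemma horner_path_gt0 q : (forall t, 0 <= t <= 1 -> q.[t] != 0) ->
  0 < q.[0] -> 0 < q.[1].
Proof.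
move=> h q0; rewrite ltNge le_eqVlt (negbTE (h 1 _)) ?lexx ?ler01 //=.
apply/negP => q1.
have [|t] := @poly_ivtoo _ q 0 1 ler01; first by rewrite pmulr_rlt0.
rewrite in_itv /= => /andP[t0 t1]; rewrite rootE; apply/negP/h.
by rewrite !ltW.
Qed.

Lemma horner_nondecr q (b : R) : 0 <= b ->
  (forall t, 0 < t -> 0 <= q^`().[t]) -> q.[0] <= q.[b].
Proof.
move=> b0 h; apply: (@ler_hornerW _ 0 b) => //; rewrite ?in_itv /= ?lexx ?b0 //.
by move=> t; rewrite in_itv /= => /andP[t0 _]; exact: h.
Qed.

Lemma horner_incr q (b : R) : 0 < b ->
  (forall t, 0 < t -> 0 < q^`().[t]) -> q.[0] < q.[b].
Proof.
move=> b0 h; apply: (@ltr_hornerW _ _ 0 b) => //; rewrite ?in_itv /= ?lexx ?ltW //.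
by move=> t; rewrite in_itv /= => /andP[t0 _]; exact: h.
Qed.

(** For a real-rooted [q], the logarithmic derivative [q'/q] decreases off the
    roots; the claim is this inequality at [0], proved root by root. *)
Lemma laguerre0 (rs : seq R) (q := \prod_(a <- rs) ('X - a%:P)) :
  q.[0] != 0 ->
  ((0 < size rs)%N -> 0 < q^`().[0] ^+ 2 - q.[0] * q^`()^`().[0]) /\
  0 <= q^`().[0] ^+ 2 - q.[0] * q^`()^`().[0].
Proof.
rewrite {}/q; elim: rs => [|a rs IH].
  by rewrite big_nil !derivE !hornerE => _; split=> //; rewrite expr2 mulr0 subr0.
rewrite big_cons; set Q := \prod_(_ <- _) _ in IH *.
rewrite hornerM mulf_eq0 negb_or => /andP[a0 Q0].
have [_ H] := IH Q0.
rewrite derivM derivXsubC mul1r derivD derivM derivXsubC mul1r !(hornerXsubC, hornerM, hornerD).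
rewrite sub0r; move: a0; rewrite hornerXsubC sub0r oppr_eq0 => a0.
set q0 := Q.[0] in Q0 H *; set q1 := Q^`().[0] in H *.
set q2 := Q^`()^`().[0] in H *.
have G : 0 < q0 ^+ 2 by rewrite exprn_even_gt0.
have Ha : 0 <= a ^+ 2 * (q1 ^+ 2 - q0 * q2) by rewrite mulr_ge0 ?sqr_ge0.
suff K : 0 < (q0 + - a * q1) ^+ 2 - - a * q0 * (q1 + (q1 + - a * q2)).
  by split=> // ; exact: ltW.
nra.
Qed.

(** Equality in the arithmetic-harmonic mean inequality: if [A] is the
    arithmetic mean, the hypothesis makes the sum of the [(x - A)^2 / x]
    vanish. *)
Lemma amhm_eq (mu : seq R) : (forall x, x \in mu -> 0 < x) ->
  (\sum_(x <- mu) x) * (\sum_(x <- mu) x^-1) = (size mu)%:R ^+ 2 ->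
  forall x, x \in mu -> x = (\sum_(x <- mu) x) / (size mu)%:R.
Proof.
move=> mu0 E x xmu; set S := \sum_(x <- mu) x in E *.
set N := (size mu)%:R in E *.
have N0 : 0 < N by rewrite ltr0n; case: (mu) xmu.
have S0 : 0 < S.
  rewrite /S (big_rem x) //= ltr_pwDl ?mu0 // big_seq sumr_ge0 // => y.
  by move/mem_rem/mu0/ltW.
set A := S / N.
have Z : \sum_(y <- mu) (y - A) ^+ 2 / y = 0.
  rewrite big_seq (eq_bigr (fun y => y - A *+ 2 + A ^+ 2 * y^-1)); last first.
    by move=> y /mu0 y0; field; rewrite gt_eqF.
  rewrite -big_seq !big_split /= -mulr_sumr -/S.
  rewrite big_const_seq count_predT iter_addr_0.
  have -> : \sum_(i <- mu) i^-1 = N ^+ 2 / S by rewrite -E; field; rewrite gt_eqF.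
  by rewrite -mulr_natr -/N /A; field; rewrite !gt_eqF.
have := Z; rewrite big_seq => /eqP.
rewrite psumr_eq0; last by move=> y /mu0 y0; rewrite mulr_ge0 ?sqr_ge0 ?invr_ge0 ?ltW.
move=> /allP /(_ x xmu); rewrite xmu /= mulf_eq0 invr_eq0 [x == 0]gt_eqF ?mu0 // orbF.
by rewrite sqrf_eq0 subr_eq0 => /eqP.
Qed.

End RealPolynomials.

(** * Complex numbers and real-rooted polynomials *)

Section ComplexPolynomials.
Context {R : realType}.
Local Notation C := R[i].
Implicit Types (q : {poly R}) (z w : C).

Lemma complex_Im0 z : Im z = 0 -> z = toC R (Re z).
Proof. by case: z => x y /= ->. Qed.

Lemma real_rooted_split q : real_rooted q ->
  exists rs : seq R, q = lead_coef q *: \prod_(a <- rs) ('X - a%:P).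
Proof.
move=> rr; have [q0|q0] := eqVneq q 0.
  by exists [::]; rewrite q0 lead_coef0 scale0r.
have [rs E] := closed_field_poly_normal (map_poly (toC R) q).
have lc0 : lead_coef (map_poly (toC R) q) != 0.
  by rewrite lead_coef_eq0 map_poly_eq0.
have Hrs z : z \in rs -> z = toC R (Re z).
  move=> zrs; apply/complex_Im0/rr.
  by rewrite E rootZ // root_prod_XsubC.
exists (map (@complex.Re R) rs); apply: (map_poly_inj (toC R)).
rewrite {1}E linearZ /= lead_coef_map; congr (_ *: _).
rewrite big_map rmorph_prod /= big_seq [RHS]big_seq; apply: eq_bigr => z /Hrs h.
by rewrite rmorphB /= map_polyX map_polyC /= -h.
Qed.

Lemma Im_inv_gt0 z : Im z < 0 -> 0 < Im z^-1.
Proof.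
case: z => a b /= b0; rewrite -mulNr divr_gt0 ?oppr_gt0 //.
by rewrite ltr_wpDl ?sqr_ge0 // exprn_even_gt0 //= (lt_eqF b0).
Qed.

(** Gauss-Lucas: [q'/q] at [0] is the sum of the [-1/rho], each of which has
    negative imaginary part. *)
Lemma gauss_lucas0 (q : {poly C}) : (1 < size q)%N ->
  (forall z, 0 <= Im z -> q.[z] != 0) -> q^`().[0] != 0.
Proof.
move=> sq h; have [rs E] := closed_field_poly_normal q.
have q0 : q != 0 by rewrite -size_poly_gt0; apply: leq_trans sq.
have lc0 : lead_coef q != 0 by rewrite lead_coef_eq0.
have Hrs z : z \in rs -> Im z < 0.
  move=> zrs; rewrite ltNge; apply/negP => /h /negP; apply.
  by rewrite -rootE E rootZ // root_prod_XsubC.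
have rs0 : (0 < size rs)%N.
  by move: sq; rewrite E size_scale // size_prod_XsubC.
rewrite E derivZ hornerZ mulf_neq0 //.
clear E h sq.
pose L (rs : seq C) := (\prod_(z <- rs) ('X - z%:P))^`().[0] /
  (\prod_(z <- rs) ('X - z%:P)).[0].
have : [/\ (\prod_(z <- rs) ('X - z%:P)).[0] != 0, Im (L rs) <= 0 &
  (0 < size rs)%N -> Im (L rs) < 0].
  elim: rs Hrs {rs0} => [|r rs IH] Hrs.
    rewrite /L big_nil -polyC1 derivC hornerC horner0 mul0r.
    by split; rewrite ?oner_eq0 //=.
  have [|P0 PI _] := IH; first by move=> z zrs; apply: Hrs; rewrite inE zrs orbT.
  have ri : Im r < 0 by apply: Hrs; rewrite inE eqxx.
  have r0 : r != 0 by apply: contraTneq ri => ->; rewrite ltxx.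
  move: P0 PI; rewrite /L big_cons; set P := \prod_(_ <- _) _ => P0 PI.
  rewrite derivM derivXsubC mul1r hornerD !hornerM hornerXsubC sub0r.
  have -> : (P.[0] + - r * P^`().[0]) / (- r * P.[0]) =
      P^`().[0] / P.[0] - r^-1.
    by field; rewrite P0 r0.
  have ri' := Im_inv_gt0 ri.
  have PI' : Im (P^`().[0] / P.[0] - r^-1) < 0 by rewrite raddfB /=; lra.
  by split; rewrite ?ltW // mulf_neq0 // oppr_eq0.
move=> [P0 _ /(_ rs0) PI]; apply: contraTneq PI.
by rewrite /L => ->; rewrite mul0r ltxx.
Qed.

Lemma normc_ge0 z : 0 <= normc z.
Proof. by case: z => x y; exact: sqrtr_ge0. Qed.

Lemma normc_eq0 z : (normc z == 0) = (z == 0).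
Proof.
by apply/eqP/eqP => [/Normc.eq0_normc //|->]; exact: Normc.normc0.
Qed.

Lemma normc_gt0 z : (0 < normc z) = (z != 0).
Proof. by rewrite lt_def normc_ge0 normc_eq0 andbT. Qed.

Lemma normc_real (x : R) : normc (toC R x) = `|x|.
Proof. by rewrite /= expr0n addr0 sqrtr_sqr. Qed.

Lemma Im_le_normc z : Im z <= normc z.
Proof.
case: z => x y /=; apply: le_trans (ler_norm y) _.
by rewrite -sqrtr_sqr ler_sqrt ?addr_ge0 ?sqr_ge0 // lerDr sqr_ge0.
Qed.

Lemma normc_prod (I : eqType) (s : seq I) (f : I -> C) :
  normc (\prod_(i <- s) f i) = \prod_(i <- s) normc (f i).
Proof.
elim: s => [|i s IH]; first by rewrite !big_nil Normc.normc1.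
by rewrite !big_cons Normc.normcM IH.
Qed.

End ComplexPolynomials.

Section RealInduction.
Context {R : realType}.

(** Connectedness of the unit interval, by looking at the supremum of the
    initial segments on which [P] holds. *)
Lemma unit_interval_clopen (P : R -> Prop) :
  P 0 ->
  (forall u, 0 <= u <= 1 -> P u -> exists2 d, 0 < d &
    forall v, 0 <= v <= 1 -> `|v - u| < d -> P v) ->
  (forall u, 0 <= u <= 1 -> ~ P u -> exists2 d, 0 < d &
    forall v, 0 <= v <= 1 -> `|v - u| < d -> ~ P v) ->
  P 1.
Proof.
move=> P0 oP oN.
pose S := [set u : R | 0 <= u <= 1 /\ forall v, 0 <= v <= u -> P v].
have S0 : S 0.
  by split=> [|v /andP[v0 v1]]; rewrite ?lexx ?ler01 // (@le_anti _ _ v 0) ?v0 ?v1.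
have ubS : ubound S 1 by move=> u [/andP[]].
have hS : has_sup S by split; [exists 0 | exists 1].
set s := sup S.
have s0 : 0 <= s by apply: (ub_le_sup hS.2).
have s1 : s <= 1 by apply: ge_sup => //; exists 0.
have s01 : 0 <= s <= 1 by rewrite s0.
have near d : 0 < d -> exists2 w, S w & s - d < w by move/sup_adherent; apply.
have [Ps|nPs] := pselect (P s); last first.
  have [d d0 hd] := oN s s01 nPs; have [w [w01 Sw] ws] := near d d0.
  have wles : w <= s by apply: (ub_le_sup hS.2).
  exfalso; apply: (hd w w01); last by apply: Sw; rewrite lexx andbT; case/andP: w01.
  by rewrite ler0_norm ?subr_le0 //; lra.
have [d d0 hd] := oP s s01 Ps; have [w [w01 Sw] ws] := near d d0.
have ext v : 0 <= v <= 1 -> v < s + d -> P v.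
  move=> /andP[v0 v1] vs; have [vw|wv] := leP v w; first by apply: Sw; rewrite v0.
  by apply: hd; rewrite ?v0 // ltr_norml; apply/andP; split; lra.
have [|s_lt1] := leP 1 s; first by move=> s_ge1; apply: ext; rewrite ?lexx ?ler01 //; lra.
pose m := Num.min (s + d / 2) 1.
have ms : s < m by rewrite lt_min s_lt1 andbT ltrDl divr_gt0.
have Sm : S m.
  split; first by rewrite ge_min lexx orbT andbT; lra.
  move=> v /andP[v0]; rewrite le_min => /andP[vsd v1].
  by apply: ext; rewrite ?v0 //; lra.
by have := ub_le_sup hS.2 Sm; rewrite leNgt -/s ms.
Qed.

End RealInduction.

(** * Continuity of roots *)

Section RootHomotopy.
Context {R : realType} {n : nat}.
Local Notation C := R[i].
Implicit Types (p : {mpoly R[n]}) (u v : R) (z : C).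

(** Growth in [z] is tracked because the roots whose motion is studied are not
    known to stay in a bounded region. *)
Definition lip_growth (d : nat) (phi : R -> C -> C) : Prop :=
  exists2 M : R, 0 <= M & forall u z, 0 <= u <= 1 ->
    normc (phi u z) <= M * (1 + normc z) ^+ d /\
    forall v, 0 <= v <= 1 ->
      normc (phi u z - phi v z) <= `|u - v| * (M * (1 + normc z) ^+ d).

Lemma lip_growthD d phi psi : lip_growth d phi -> lip_growth d psi ->
  lip_growth d (fun u z => phi u z + psi u z).
Proof.
move=> [M M0 HM] [N N0 HN]; exists (M + N); first exact: addr_ge0.
move=> u z hu; have [a1 a2] := HM u z hu; have [b1 b2] := HN u z hu; split.
  by apply: le_trans (le_normcD _ _) _; rewrite mulrDl lerD.
move=> v hv; have := a2 v hv; have := b2 v hv.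
rewrite opprD addrACA mulrDl mulrDr => h1 h2.
by apply: le_trans (le_normcD _ _) _; rewrite lerD.
Qed.

Lemma lip_growthM d e phi psi : lip_growth d phi -> lip_growth e psi ->
  lip_growth (d + e) (fun u z => phi u z * psi u z).
Proof.
move=> [M M0 HM] [N N0 HN].
exists (2 * (M * N)); first by rewrite !mulr_ge0.
move=> u z hu; have [a1 a2] := HM u z hu; have [b1 b2] := HN u z hu.
set X := 1 + normc z in a1 a2 b1 b2 *.
have X0 : 0 <= X by rewrite addr_ge0 ?normc_ge0.
have E : M * N * X ^+ (d + e) = (M * X ^+ d) * (N * X ^+ e).
  by rewrite exprD; ring.
have MN0 : 0 <= M * N * X ^+ (d + e) by rewrite !mulr_ge0 ?exprn_ge0.
split.
  rewrite Normc.normcM -mulrA; apply: (@le_trans _ _ (M * N * X ^+ (d + e))).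
    by rewrite E ler_pM ?normc_ge0.
  by rewrite ler_peMl // ler1n.
move=> v hv; have Ha := a2 v hv; have Hb := b2 v hv.
have [a1' _] := HM v z hv.
have -> : phi u z * psi u z - phi v z * psi v z =
    (phi u z - phi v z) * psi u z + phi v z * (psi u z - psi v z) by ring.
apply: le_trans (le_normcD _ _) _; rewrite !Normc.normcM.
have -> : `|u - v| * (2 * (M * N) * X ^+ (d + e)) =
   (`|u - v| * (M * X ^+ d)) * (N * X ^+ e) +
   (M * X ^+ d) * (`|u - v| * (N * X ^+ e)) by rewrite exprD; ring.
by apply: lerD; apply: ler_pM; rewrite ?normc_ge0.
Qed.

Definition cev p (w : 'I_n -> C) : C := mmap (toC R) w p.

Lemma lip_growth_cev d p (a w0 w1 : 'I_n -> C) : p \is d.-homog ->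
  lip_growth d (fun u z => cev p (fun i => z * a i + w0 i + toC R u * w1 i)).
Proof.
move: d p; apply: dhomog_ind => [d|c|i|d p q Hp Hq|d1 d2 p q Hp Hq].
- exists 0 => // u z hu; rewrite /cev.
  by split=> [|v hv]; rewrite !mmap0 ?subrr Normc.normc0 mul0r ?mulr0.
- exists (normc (toC R c)); rewrite ?normc_ge0 // => u z hu.
  rewrite /cev expr0 mulr1.
  split=> [|v hv]; first by rewrite mmapC.
  by rewrite !mmapC subrr Normc.normc0 mulr_ge0 ?normc_ge0.
- exists (normc (a i) + normc (w0 i) + normc (w1 i)).
    by rewrite !addr_ge0 ?normc_ge0.
  move=> u z /andP[u0 u1]; rewrite /cev expr1; split.
    rewrite mmapX mmap1U.
    apply: le_trans (le_normcD _ _) _.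
    have h1 : normc (z * a i + w0 i) <= normc z * normc (a i) + normc (w0 i).
      by rewrite -Normc.normcM; exact: le_normcD.
    have h2 : normc (toC R u * w1 i) <= normc (w1 i).
      rewrite Normc.normcM normc_real ger0_norm //.
      by rewrite ler_piMl ?normc_ge0.
    apply: le_trans (lerD h1 h2) _.
    have := normc_ge0 z; have := normc_ge0 (a i).
    have := normc_ge0 (w0 i); have := normc_ge0 (w1 i).
    set A := normc (a i); set B := normc (w0 i); set D := normc (w1 i).
    set Z := normc z => D0 B0 A0 Z0.
    have : 0 <= Z * B by exact: mulr_ge0.
    have : 0 <= Z * D by exact: mulr_ge0.
    lra.
  move=> v hv; rewrite !mmapX !mmap1U.
  have -> : z * a i + w0 i + toC R u * w1 i - (z * a i + w0 i + toC R v * w1 i)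
    = toC R (u - v) * w1 i by rewrite rmorphB; ring.
  rewrite Normc.normcM normc_real ler_wpM2l //.
  have := normc_ge0 z; have := normc_ge0 (a i).
  have := normc_ge0 (w0 i); have := normc_ge0 (w1 i).
  set A := normc (a i); set B := normc (w0 i); set D := normc (w1 i).
  set Z := normc z => D0 B0 A0 Z0.
  have : 0 <= Z * B by exact: mulr_ge0.
  have : 0 <= Z * D by exact: mulr_ge0.
  have : 0 <= Z * A by exact: mulr_ge0.
  lra.
- have [M M0 HM] := lip_growthD Hp Hq; exists M => // u z hu.
  have [h1 h2] := HM u z hu; rewrite /cev; split=> [|v hv]; rewrite !mmapD //.
  exact: h2.
- have [M M0 HM] := lip_growthM Hp Hq; exists M => // u z hu.
  have [h1 h2] := HM u z hu; rewrite /cev.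
  by split=> [|v hv]; rewrite !(mmap_is_multiplicative _ _).1 //; exact: h2.
Qed.

Lemma cev_ext p (w w' : 'I_n -> C) : w =1 w' -> cev p w = cev p w'.
Proof. by move=> /funext ->. Qed.

Lemma cev_homog d p (w : 'I_n -> C) (a : C) : p \is d.-homog ->
  cev p (fun i => a * w i) = a ^+ d * cev p w.
Proof. exact: mmap_homog. Qed.

(** The degree of the restriction is exactly [d], its leading coefficient being
    the value of [p] at the direction. *)
Lemma cev_line_split d p (w a : 'I_n -> C) : p \is d.-homog -> cev p a != 0 ->
  exists2 rs : seq C, size rs = d &
    forall z, cev p (fun i => w i + z * a i) =
              cev p a * \prod_(r <- rs) (z - r).
Proof.
move=> hp pa; pose q := gline (toC R) p w a.
have ev z : q.[z] = cev p (fun i => w i + z * a i) by exact: horner_gline.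
have rev z : z != 0 -> q.[z] = z ^+ d * (gline (toC R) p a w).[z^-1].
  move=> z0; rewrite ev horner_gline -(mmap_homog _ _ _ hp).
  by apply: cev_ext => i; rewrite mulrDr mulrA mulfV // mul1r addrC.
have cq : q`_d = cev p a.
  rewrite (coef_reverse rev) leqnn subnn -horner_coef0 horner_gline.
  by apply: cev_ext => i; rewrite mul0r addr0.
have sq : size q = d.+1.
  apply/eqP; rewrite eqn_leq (size_reverse rev) /=.
  by rewrite ltnNge; apply: contra pa => /leq_sizeP/(_ d (leqnn d)); rewrite cq => ->.
have [rs E] := closed_field_poly_normal q.
have lq : lead_coef q = cev p a by rewrite lead_coefE sq.
exists rs.
  have := congr1 (fun q : {poly C} => size q) E.
  by rewrite sq lq /= size_scale // size_prod_XsubC => -[].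
move=> z; rewrite -ev {1}E lq hornerZ horner_prod; congr (_ * _).
by apply: eq_bigr => r _; rewrite hornerXsubC.
Qed.

(** Roots of the restrictions of [p] to a family of parallel complex lines
    depend continuously on the line, hence none can pass from one half plane
    to the other without crossing the real axis. The condition [cev p a != 0]
    keeps the degree constant, so that no root comes from infinity. *)
Lemma root_homotopy d p (a w0 w1 : 'I_n -> C) : p \is d.-homog ->
  cev p a != 0 ->
  (forall u t : R, 0 <= u <= 1 ->
     cev p (fun i => toC R t * a i + w0 i + toC R u * w1 i) != 0) ->
  (forall z, 0 <= Im z -> cev p (fun i => z * a i + w0 i) != 0) ->
  forall z, 0 <= Im z -> cev p (fun i => z * a i + w0 i + w1 i) != 0.
Proof.
move=> hp pa hreal h0 z1 z1i.
pose F u z := cev p (fun i => z * a i + w0 i + toC R u * w1 i).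
suff H : forall z, 0 < Im z -> F 1 z != 0.
  have -> : cev p (fun i => z1 * a i + w0 i + w1 i) = F 1 z1.
    by apply: cev_ext => i; rewrite rmorph1 mul1r.
  move: z1i; rewrite le_eqVlt => /orP[/eqP z1r|]; last exact: H.
  rewrite (complex_Im0 (esym z1r)); apply: hreal.
  by rewrite ler01 lexx.
have [M M0 HM] := lip_growth_cev a w0 w1 hp.
have split u : exists2 rs : seq C, size rs = d &
    forall z, F u z = cev p a * \prod_(r <- rs) (z - r).
  have [rs s E] := cev_line_split (fun i => w0 i + toC R u * w1 i) hp pa.
  exists rs => // z; rewrite -E; apply: cev_ext => i.
  by rewrite -addrA addrC.
have c0 : 0 < normc (cev p a) by rewrite normc_gt0.
set c := normc (cev p a) in c0.
have roots_low u rs : 0 <= u <= 1 -> (forall z, 0 < Im z -> F u z != 0) ->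
    (forall z, F u z = cev p a * \prod_(r <- rs) (z - r)) ->
    forall r, r \in rs -> Im r < 0.
  move=> hu Pu E r rin; have Fr : F u r = 0.
    by rewrite E (big_rem r) //= subrr mul0r mulr0.
  rewrite ltNge le_eqVlt; apply/negP => /orP[/eqP r0|/Pu]; last by rewrite Fr eqxx.
  have /negP[] := hreal u (Re r) hu.
  by rewrite -(complex_Im0 (esym r0)); apply/eqP.
apply: (@unit_interval_clopen R (fun u => forall z, 0 < Im z -> F u z != 0)).
- move=> z z0; have -> : F 0 z = cev p (fun i => z * a i + w0 i).
    by apply: cev_ext => i; rewrite rmorph0 mul0r addr0.
  exact/h0/ltW.
- move=> u hu Pu; have [rs srs E] := split u; have low := roots_low u rs hu Pu E.
  have [K K0 HK] : exists2 K : R, 0 < K & forall z, 0 < Im z ->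
      (1 + normc z) ^+ d <= K * normc (F u z).
    (* A root in the open lower half plane stays at a distance comparable to
       [1 + |z|] from the upper half plane: the ratio is bounded by
       [1 + (1 + |r|) / |Im r|]. *)
    have [K K0 HK] : exists2 K : R, 0 < K & forall z, 0 < Im z ->
        (1 + normc z) ^+ size rs <= K * \prod_(r <- rs) normc (z - r).
      elim: rs low {srs E} => [|r rs IH] low.
        by exists 1 => // z _; rewrite big_nil expr0 mulr1.
      have [|K K0 HK] := IH; first by move=> s sin; apply: low; rewrite inE sin orbT.
      have ri : Im r < 0 by apply: low; rewrite inE eqxx.
      pose k := 1 + (1 + normc r) / (- Im r).
      have k0 : 0 < k.
        by rewrite ltr_wpDr // divr_ge0 ?addr_ge0 ?normc_ge0 // oppr_ge0 ltW.
      exists (k * K); first exact: mulr_gt0.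
      move=> z zi; rewrite exprS big_cons mulrACA.
      apply: ler_pM; rewrite ?exprn_ge0 ?addr_ge0 ?normc_ge0 //; last exact: HK.
      have h1 : - Im r <= normc (z - r).
        by apply: le_trans (Im_le_normc _); rewrite raddfB /= lerDr ltW.
      have h2 : normc z <= normc (z - r) + normc r.
        by rewrite -{1}(subrK r z); exact: le_normcD.
      have h3 : 1 + normc r <= (1 + normc r) / (- Im r) * normc (z - r).
        rewrite mulrAC ler_pdivlMr ?oppr_gt0 // ler_wpM2l //.
        by rewrite addr_ge0 ?normc_ge0.
      by rewrite /k mulrDl mul1r; lra.
    exists (K / c); first exact: divr_gt0.
    move=> z zi; rewrite -srs; apply: le_trans (HK z zi) _.
    rewrite E Normc.normcM normc_prod -/c.
    by rewrite (_ : _ / _ * _ = K * \prod_(r <- rs) normc (z - r)) //; field; rewrite gt_eqF.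
  exists (M * K + 1)^-1; first by rewrite invr_gt0 ltr_wpDl ?mulr_ge0 // ltW.
  move=> v hv uv z zi; apply/eqP => Fv.
  have [_ /(_ v hv)] := HM u z hu; rewrite -/(F u z) -/(F v z) Fv subr0 => h1.
  have h2 := HK z zi; have Fu : 0 < normc (F u z) by rewrite normc_gt0 Pu.
  have h3 : normc (F u z) <= `|u - v| * (M * K) * normc (F u z).
    apply: le_trans h1 _; rewrite -!mulrA ler_wpM2l // ler_wpM2l //.
  move: h3; rewrite -{1}[normc (F u z)]mul1r ler_pM2r // distrC => h3.
  have MK : 0 <= M * K by rewrite mulr_ge0 // ltW.
  have := ler_wpM2r MK (ltW uv); move/(le_trans h3).
  by rewrite mulrC ler_pdivlMr ?ltr_wpDl //; lra.
- (* At [z] above the real axis, a polynomial of the family with all its roots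
     below the axis has modulus at least [c (Im z) ^ d]. *)
  move=> u hu nPu.
  have [z [zi Fz]] : exists z, 0 < Im z /\ F u z = 0.
    apply: contrapT => h; apply: nPu => z zi; apply/eqP => Fz; apply: h.
    by exists z.
  set B := M * (1 + normc z) ^+ d.
  have B0 : 0 <= B by rewrite mulr_ge0 // exprn_ge0 // addr_ge0 ?normc_ge0.
  pose D := c * Im z ^+ d; have D0 : 0 < D by rewrite mulr_gt0 // exprn_gt0.
  exists (D / (B + 1)); first by rewrite divr_gt0 // ltr_wpDl.
  move=> v hv uv Pv; have [rs srs E] := split v.
  have low := roots_low v rs hv Pv E.
  have h1 : D <= normc (F v z).
    rewrite E Normc.normcM /D ler_wpM2l ?(ltW c0) // normc_prod -srs.
    elim: rs low {srs E} => [|r rs IH] low; first by rewrite big_nil.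
    rewrite exprS big_cons ler_pM ?exprn_ge0 ?(ltW zi) //; last first.
      by apply: IH => s sin; apply: low; rewrite inE sin orbT.
    have ri : Im r < 0 by apply: low; rewrite inE eqxx.
    by apply: le_trans (Im_le_normc _); rewrite raddfB /= lerDl oppr_ge0 ltW.
  have [_ /(_ v hv)] := HM u z hu.
  rewrite -/(F u z) -/(F v z) Fz sub0r normcN distrC -/B => /(le_trans h1) h2.
  move: uv; rewrite ltr_pdivlMr ?ltr_wpDl // => h3.
  by have := normr_ge0 (v - u); rewrite mulrDr mulr1 in h3; lra.
Qed.

End RootHomotopy.

(** * Hyperbolicity cones are convex *)

Section Hyperbolic.
Context {R : realType} {n : nat}.
Local Notation C := R[i].
Implicit Types (p g : {mpoly R[n]}) (x y v e a b : 'cV[R]_n).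

Definition ev p x : R := p.@[fun i => x i 0].

Lemma line_polyE p x v t : (line_poly p x v).[t] = ev p (x + t *: v).
Proof. exact: horner_line_poly. Qed.

Lemma evD p g x : ev (p + g) x = ev p x + ev g x.
Proof. exact: mevalD. Qed.

Lemma evZ c p x : ev (c *: p) x = c * ev p x.
Proof. exact: mevalZ. Qed.

Lemma ev0 x : ev 0 x = 0.
Proof. exact: meval0. Qed.

Lemma deriv_line p x v : (line_poly p x v)^`() = line_poly (dirD v p) x v.
Proof. exact: (deriv_gline idfun p (fun i => x i 0) v). Qed.

Lemma ev_homog d p c x : p \is d.-homog -> ev p (c *: x) = c ^+ d * ev p x.
Proof.
move=> hp; rewrite /ev /meval -(mmap_homog idfun _ _ hp).
by congr (mmap _ _ _); apply/funext => i; rewrite mxE.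
Qed.

Lemma ev_homogN d p x : p \is d.-homog -> ev p (- x) = (-1) ^+ d * ev p x.
Proof. by move=> hp; rewrite -scaleN1r (ev_homog _ _ hp). Qed.

Lemma euler d p x : p \is d.+1.-homog -> ev (dirD x p) x = d.+1%:R * ev p x.
Proof.
move=> hp; have E : line_poly p x x = ev p x *: ('X + 1) ^+ d.+1.
  apply: (@poly_eq_neq0 R) => t _; rewrite line_polyE -{1}[x]scale1r -scalerDl.
  by rewrite (ev_homog _ _ hp) !hornerE mulrC addrC.
have := congr1 (fun q : {poly R} => q^`().[0]) E; rewrite deriv_line line_polyE.
rewrite scale0r addr0 => ->; rewrite derivZ deriv_exp !derivE !hornerE.
by rewrite hornerMn !hornerE expr1n mulrC.
Qed.

Lemma line_reverse d p x v z : p \is d.-homog -> z != 0 ->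
  (line_poly p x v).[z] = z ^+ d * (line_poly p v x).[z^-1].
Proof.
move=> hp z0; rewrite !line_polyE -(ev_homog _ _ hp) scalerDr scalerA mulfV //.
by rewrite scale1r addrC.
Qed.

Lemma coef_line_reverse d p x v j : p \is d.-homog ->
  (line_poly p x v)`_j = if (j <= d)%N then (line_poly p v x)`_(d - j) else 0.
Proof. by move=> hp; apply: coef_reverse => z; exact: line_reverse. Qed.

Lemma coef0_line p x v : (line_poly p x v)`_0 = ev p x.
Proof. by rewrite -horner_coef0 line_polyE scale0r addr0. Qed.

Lemma coef_top_line d p x v : p \is d.-homog -> (line_poly p x v)`_d = ev p v.
Proof. by move=> hp; rewrite (coef_line_reverse _ _ _ hp) leqnn subnn coef0_line. Qed.

Lemma size_line d p x v : p \is d.-homog -> ev p v != 0 ->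
  size (line_poly p x v) = d.+1.
Proof.
move=> hp pv; apply/eqP; rewrite eqn_leq; apply/andP; split.
  by apply: (@size_reverse R d _ (line_poly p v x)) => z; exact: line_reverse.
rewrite ltnNge; apply: contra pv => /leq_sizeP /(_ d (leqnn d)).
by rewrite (coef_top_line _ _ hp) => ->.
Qed.

Lemma lead_coef_line d p x v : p \is d.-homog -> ev p v != 0 ->
  lead_coef (line_poly p x v) = ev p v.
Proof.
by move=> hp pv; rewrite lead_coefE (size_line _ hp) // (coef_top_line _ _ hp).
Qed.

Definition cpt x y : 'I_n -> C := fun i => toC R (x i 0) + 'i%C * toC R (y i 0).

Lemma cev_real p x : cev p (fun i => toC R (x i 0)) = toC R (ev p x).
Proof.
rewrite /cev /ev /meval /mmap rmorph_sum; apply: eq_bigr => m _.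
rewrite rmorphM /= /mmap1 rmorph_prod; congr (_ * _).
by apply: eq_bigr => i _; rewrite rmorphXn.
Qed.

Lemma horner_map_line p x v z : (map_poly (toC R) (line_poly p x v)).[z] =
  cev p (fun i => toC R (x i 0) + z * toC R (v i 0)).
Proof.
have -> : map_poly (toC R) (line_poly p x v) =
    gline (toC R) p (fun i => toC R (x i 0)) (fun i => toC R (v i 0)).
  rewrite /line_poly /gline /mmap rmorph_sum; apply: eq_bigr => m _.
  rewrite rmorphM /= map_polyC /mmap1 rmorph_prod; congr (_ * _).
  apply: eq_bigr => i _; rewrite rmorphXn rmorphD /= map_polyC /=.
  by rewrite map_polyZ /= map_polyX.
exact: horner_gline.
Qed.

(** Hyperbolicity along [e]; since [p] is homogeneous, every nonreal parameter
    can be rescaled to the imaginary unit. *)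
Definition hyp d p e : Prop :=
  [/\ p \is d.-homog, 0 < ev p e & forall y, cev p (cpt y e) != 0].

Lemma hyperbolic_hyp d p e : p \is d.-homog -> hyperbolic p e -> hyp d p e.
Proof.
move=> hp [pe rr]; split=> // y; apply/eqP => h.
have := rr y (- 'i%C); rewrite rootE horner_map_line (_ : cev _ _ = 0).
  by move=> /(_ (eqxx _)) /= /eqP; rewrite oppr_eq0 oner_eq0.
by rewrite -h; apply: cev_ext => i; rewrite mxE rmorphN mulrNN.
Qed.

(** The interior of the hyperbolicity cone: all eigenvalues are positive. *)
Definition hyp_int p e : set 'cV[R]_n :=
  [set x | forall s, 0 <= s -> ev p (x + s *: e) != 0].

Lemma hyp_intE p e x s : hyp_int p e x -> 0 <= s -> ev p (x + s *: e) != 0.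
Proof. by move=> Ix; exact: Ix. Qed.

Section Fixed.
Context (d : nat) (p : {mpoly R[n]}) (e : 'cV[R]_n) (H : hyp d p e).

Let hp : p \is d.-homog. Proof. by case: H. Qed.
Let pe : 0 < ev p e. Proof. by case: H. Qed.

Lemma hyp_cev_neq0 x z : Im z != 0 ->
  cev p (fun i => toC R (x i 0) + z * toC R (e i 0)) != 0.
Proof.
case: z => s t /= t0; have [_ _ /(_ (t^-1 *: (x + s *: e))) h] := H.
have -> : cev p (fun i => toC R (x i 0) + (s +i* t)%C * toC R (e i 0)) =
    toC R t ^+ d * cev p (cpt (t^-1 *: (x + s *: e)) e).
  have tC : toC R t != 0 by rewrite fmorph_eq0.
  rewrite -(cev_homog _ _ hp); apply: cev_ext => i; rewrite /cpt !mxE.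
  rewrite (complexE (s +i* t)%C) /= rmorphM rmorphD rmorphM fmorphV /=.
  by field.
by rewrite mulf_neq0 // expf_neq0 // fmorph_eq0.
Qed.

Lemma hyp_real_rooted x : real_rooted (line_poly p x e).
Proof.
move=> z; rewrite rootE horner_map_line => /eqP h; apply/eqP.
by apply: contraT => /(hyp_cev_neq0 x); rewrite h eqxx.
Qed.

Let I := hyp_int p e.
Let L := hyp_cone p e.

Lemma hyp_coneP x : L x <-> forall s, 0 < s -> ev p (x + s *: e) != 0.
Proof.
have E t : (line_poly p (- x) e).[t] = (-1) ^+ d * ev p (x + (- t) *: e).
  by rewrite line_polyE -(ev_homogN _ hp) opprD scaleNr opprK.
have S t : root (line_poly p (- x) e) t = (ev p (x + (- t) *: e) == 0).
  by rewrite rootE E mulf_eq0 signr_eq0.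
split=> h s => [s0|].
  apply/negP => /eqP z; have := h (- s); rewrite S opprK z eqxx => /(_ isT).
  by rewrite oppr_ge0 leNgt s0.
by rewrite S; apply: contraTT; rewrite -ltNge -oppr_gt0 => /h.
Qed.

Lemma int_sub x : I x -> L x.
Proof. by move=> Ix; apply/hyp_coneP => s /ltW; exact: Ix. Qed.

Lemma cone_shift x s : 0 < s -> L x -> I (x + s *: e).
Proof.
move=> s0 /hyp_coneP Lx t t0; rewrite -addrA -scalerDl; apply: Lx.
by rewrite ltr_wpDr.
Qed.

Lemma int_shift x s : 0 <= s -> I x -> I (x + s *: e).
Proof.
by move=> s0 Ix t t0; rewrite -addrA -scalerDl; apply: (hyp_intE Ix); rewrite addr_ge0.
Qed.

Lemma cone_intP x : L x -> I x <-> ev p x != 0.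
Proof.
move=> /hyp_coneP Lx; split=> [/(_ 0 (lexx _))|h s]; rewrite ?scale0r ?addr0 //.
by rewrite le_eqVlt => /orP[/eqP <-|/Lx//]; rewrite scale0r addr0.
Qed.

Lemma int_neq0 x : I x -> ev p x != 0.
Proof. by move=> /(_ 0 (lexx _)); rewrite scale0r addr0. Qed.

Lemma int_scale x c : 0 < c -> I x -> I (c *: x).
Proof.
move=> c0 Ix s s0; have -> : c *: x + s *: e = c *: (x + (s / c) *: e).
  by rewrite scalerDr scalerA mulrCA mulfV ?gt_eqF // mulr1.
rewrite (ev_homog _ _ hp) mulf_neq0 ?expf_neq0 ?(gt_eqF c0) //; apply: (hyp_intE Ix).
by rewrite divr_ge0 // ltW.
Qed.

Lemma cone_arch x : (forall s, 0 < s -> L (x + s *: e)) -> L x.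
Proof.
move=> h; apply/hyp_coneP => s s0; have s2 : 0 < s / 2 by rewrite divr_gt0.
have /hyp_coneP/(_ _ s2) := h _ s2.
by rewrite -addrA -scalerDl -splitr.
Qed.

Lemma cone0 : L 0.
Proof.
apply/hyp_coneP => s s0; rewrite add0r (ev_homog _ _ hp).
by rewrite mulf_neq0 ?expf_neq0 ?gt_eqF.
Qed.

Lemma int_dir : I e.
Proof.
move=> s s0; rewrite -{1}[e]scale1r -scalerDl (ev_homog _ _ hp).
by rewrite mulf_neq0 ?expf_neq0 ?gt_eqF // ltr_wpDr.
Qed.

Lemma int_open x : I x -> exists2 s, 0 < s & I (x - s *: e).
Proof.
move=> Ix; have [|r r0 hr] := @horner0_gt0_near R (line_poly p x e ^+ 2).
  by rewrite horner_exp line_polyE exprn_even_gt0 //=; exact: (hyp_intE Ix).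
exists (r / 2); first exact: divr_gt0.
move=> t t0; rewrite -scaleNr -addrA -scalerDl.
have [h|h] := leP 0 (- (r / 2) + t); first exact: (hyp_intE Ix).
have := hr (- (r / 2) + t); rewrite ltr0_norm // horner_exp line_polyE.
have -> : - (- (r / 2) + t) < r by lra.
by rewrite exprn_even_gt0 //= => /(_ isT).
Qed.

(** [e] is an order unit: [s] is the inverse of a bound for the roots of
    [t |-> p (v + t e)]. *)
Lemma int_absorb v : exists2 s, 0 < s & forall t, 0 <= t <= s -> I (e + t *: v).
Proof.
have q0 : line_poly p v e != 0.
  by rewrite -size_poly_gt0 (size_line _ hp) // gt_eqF.
set B := cauchy_bound (line_poly p v e).
have B0 : 0 < B by exact: cauchy_bound_gt0.
exists B^-1; first by rewrite invr_gt0.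
move=> t /andP[]; rewrite le_eqVlt => /orP[/eqP <- _|t0 tB].
  by rewrite scale0r addr0; exact: int_dir.
move=> s s0; have -> : e + t *: v + s *: e = t *: (v + ((1 + s) / t) *: e).
  rewrite scalerDr scalerA mulrCA mulfV ?gt_eqF // mulr1 scalerDl scale1r.
  by rewrite addrAC [RHS]addrC.
rewrite (ev_homog _ _ hp) mulf_neq0 ?expf_neq0 ?(gt_eqF t0) // -line_polyE.
apply: (ge_cauchy_bound q0); rewrite in_itv /= andbT -/B.
rewrite ler_pdivlMr // mulrC (@le_trans _ _ 1) ?lerDl //.
by rewrite -ler_pdivlMr // div1r.
Qed.

Lemma int_absorb_large y : exists T, forall t, T <= t -> I (y + t *: e).
Proof.
have [s s0 /(_ s)] := int_absorb y; rewrite lexx ltW // => /(_ isT) h.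
exists s^-1 => t ht; have -> : y + t *: e =
    s^-1 *: (e + s *: y) + (t - s^-1) *: e.
  rewrite scalerDr scalerA mulVf ?gt_eqF // scale1r scalerBl.
  by rewrite [_ + y]addrC -addrA; congr (_ + _); rewrite addrC subrK.
apply: int_shift; first by rewrite subr_ge0.
by apply: int_scale; rewrite ?invr_gt0.
Qed.

Let i0 : 'i%C != 0 :> C. Proof. by rewrite eq_complex /= oner_eq0 andbF. Qed.

(** The key step towards convexity: inside the half plane [0 <= Im z], no zero
    appears when the point [y] is moved away from the origin. *)
Lemma garding_half_plane a y z : I a -> 0 <= Im z ->
  cev p (fun i => z * toC R (a i 0) + 'i%C * toC R (e i 0) + toC R (y i 0)) != 0.
Proof.
move=> Ia; apply: (root_homotopy hp) => {z}.
- by rewrite cev_real fmorph_eq0; exact: int_neq0.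
- move=> u t _; have [_ _ /(_ (t *: a + u *: y))] := H.
  rewrite (_ : cev p _ = cev p (cpt (t *: a + u *: y) e)) //.
  apply: cev_ext => i; rewrite /cpt !mxE !rmorphD !rmorphM /=; ring.
move=> z zi; have [->|z0] := eqVneq z 0.
  have [_ _ /(_ 0)] := H; rewrite (_ : cev _ _ = cev p (cpt 0 e)) //.
  by apply: cev_ext => i; rewrite /cpt !mxE mul0r rmorph0.
have -> : cev p (fun i => z * toC R (a i 0) + 'i%C * toC R (e i 0)) =
    z ^+ d * cev p (fun i => toC R (a i 0) + 'i%C / z * toC R (e i 0)).
  rewrite -(cev_homog _ _ hp); apply: cev_ext => i.
  by field.
rewrite mulf_neq0 ?expf_neq0 //.
have [/complex_Im0 w|w] := eqVneq (Im ('i%C / z)) 0; last exact: hyp_cev_neq0.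
set s := Re ('i%C / z) in w.
have s0 : 0 <= s.
  move: zi; rewrite leNgt; apply: contraNle => sneg.
  have -> : z = 'i%C / toC R s.
    by rewrite -w; field; rewrite z0 i0.
  by rewrite -fmorphV mulrC ImiRe /= invr_lt0.
rewrite w (_ : cev _ _ = cev p (fun i => toC R ((a + s *: e) i 0))).
  by rewrite cev_real fmorph_eq0; exact: (hyp_intE Ia).
by apply: cev_ext => i; rewrite !mxE rmorphD rmorphM.
Qed.

(** Every interior direction is a direction of hyperbolicity: part of the
    direction [a] is given back to [e], the rest is multiplied by [z = i]. *)
Lemma garding_stable a y : I a -> cev p (cpt y a) != 0.
Proof.
move=> Ia; have [s s0 Is] := int_open Ia.
have sC : toC R s != 0 by rewrite fmorph_eq0 gt_eqF.
have -> : cev p (cpt y a) = toC R s ^+ d * cev p (fun i =>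
    'i%C * toC R ((s^-1 *: (a - s *: e)) i 0) + 'i%C * toC R (e i 0) +
    toC R ((s^-1 *: y) i 0)).
  rewrite -(cev_homog _ _ hp); apply: cev_ext => i; rewrite /cpt !mxE.
  by rewrite !rmorphM rmorphB rmorphM /= fmorphV; field.
rewrite mulf_neq0 ?expf_neq0 //; apply: garding_half_plane => //=.
by apply: int_scale; rewrite ?invr_gt0.
Qed.

(** Convexity. Here the homotopy runs from the direction [e] to [b + e]; no root
    is real since [u b + e] is a direction of hyperbolicity, and the value
    [z = i] of the parameter gives [p (a + b + e) != 0]. *)
Lemma garding_add a b : I a -> I b -> I (a + b).
Proof.
have key a' b' : I a' -> I b' -> ev p (a' + b' + e) != 0.
  move=> Ia Ib.
  have : cev p (fun i => 'i%C * toC R (a' i 0) + 'i%C * toC R (e i 0) +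
      'i%C * toC R (b' i 0)) != 0.
    apply: (root_homotopy hp) => //=.
    - by rewrite cev_real fmorph_eq0; exact: int_neq0.
    - move=> u t /andP[u0 _].
      have Ic : I (u *: b' + e).
        move: u0; rewrite le_eqVlt => /orP[/eqP <-|u0].
          by rewrite scale0r add0r; exact: int_dir.
        rewrite -{1}[e]scale1r; apply: int_shift => //.
        exact: int_scale.
      have := garding_stable (t *: a') Ic.
      rewrite (_ : cev p (cpt _ _) = cev p (fun i => toC R t * toC R (a' i 0) +
         'i%C * toC R (e i 0) + toC R u * ('i%C * toC R (b' i 0)))) //.
      by apply: cev_ext => i; rewrite /cpt !mxE rmorphD !rmorphM /=; ring.
    - move=> z zi; have := garding_half_plane 0 Ia zi.
      rewrite (_ : cev p _ = cev p (fun i => z * toC R (a' i 0) +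
         'i%C * toC R (e i 0))) //.
      by apply: cev_ext => i; rewrite !mxE rmorph0 addr0.
  rewrite (_ : cev _ _ = 'i%C ^+ d * cev p (fun i => toC R ((a' + b' + e) i 0))).
    by rewrite cev_real mulf_eq0 negb_or => /andP[_]; rewrite fmorph_eq0.
  rewrite -(cev_homog _ _ hp); apply: cev_ext => i.
  by rewrite !mxE !rmorphD /=; ring.
move=> Ia Ib s s0; have [r r0 Ir] := int_open Ia.
have sr : 0 < s + r by rewrite ltr_wpDl.
have -> : a + b + s *: e = (s + r) *:
    ((s + r)^-1 *: (a - r *: e) + (s + r)^-1 *: b + e).
  rewrite !scalerDr !scalerA mulfV ?gt_eqF // !scale1r scalerDl.
  by rewrite [s *: e + _]addrC addrACA subrK addrA.
rewrite (ev_homog _ _ hp) mulf_neq0 ?expf_neq0 ?(gt_eqF sr) //.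
by apply: key; apply: int_scale; rewrite ?invr_gt0.
Qed.

Lemma cone_add x y : L x -> L y -> L (x + y).
Proof.
move=> Lx Ly; apply: cone_arch => s s0; apply: int_sub.
have s2 : 0 < s / 2 by rewrite divr_gt0.
have -> : x + y + s *: e = (x + (s / 2) *: e) + (y + (s / 2) *: e).
  by rewrite addrACA -scalerDl -splitr.
by apply: garding_add; exact: cone_shift.
Qed.

Lemma cone_scale x c : 0 <= c -> L x -> L (c *: x).
Proof.
rewrite le_eqVlt => /orP[/eqP <- _|c0 Lx]; first by rewrite scale0r; exact: cone0.
apply: cone_arch => s s0; apply: int_sub.
have -> : c *: x + s *: e = c *: (x + (s / c) *: e).
  by rewrite scalerDr scalerA mulrCA mulfV ?gt_eqF // mulr1.
by apply: int_scale => //; apply: cone_shift => //; rewrite divr_gt0.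
Qed.

End Fixed.
End Hyperbolic.

(** * Derivatives of hyperbolic polynomials *)

Section StablePolynomials.
Context {R : realType} {n : nat}.
Local Notation C := R[i].
Implicit Types (p g : {mpoly R[n]}) (x y v e a b : 'cV[R]_n).

(** Polynomials that are positive on an open cone [I] and hyperbolic along all
    of its directions; this is the form of hyperbolicity that directional
    derivatives preserve. *)
Definition stable_on (I : set 'cV[R]_n) d g : Prop :=
  [/\ g \is d.-homog, forall a, I a -> 0 < ev g a &
      forall y a, I a -> cev g (cpt y a) != 0].

Lemma cev_cpt0 d g a : g \is d.-homog -> cev g (cpt 0 a) != 0 -> ev g a != 0.
Proof.
move=> hg; rewrite (_ : cev _ _ = 'i%C ^+ d * cev g (fun i => toC R (a i 0))).
  by rewrite cev_real mulf_eq0 negb_or => /andP[_]; rewrite fmorph_eq0.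
by rewrite -(cev_homog _ _ hg); apply: cev_ext => i; rewrite /cpt !mxE rmorph0 add0r.
Qed.

Section OpenCone.
Context (I : set 'cV[R]_n).
Hypothesis I_add : forall a b, I a -> I b -> I (a + b).
Hypothesis I_scale : forall a (c : R), 0 < c -> I a -> I (c *: a).

Lemma pos_on_convex g a b : (forall c, I c -> ev g c != 0) ->
  I a -> I b -> 0 < ev g b -> 0 < ev g a.
Proof.
move=> nz Ia Ib gb; have := @horner_path_gt0 R (line_poly g b (a - b)).
rewrite !line_polyE scale0r addr0 scale1r [b + _]addrC subrK; apply=> // t.
move=> /andP[t0 t1]; rewrite line_polyE; apply: nz.
have -> : b + t *: (a - b) = (1 - t) *: b + t *: a.
  by rewrite scalerBr scalerBl scale1r addrA addrAC.
move: t0; rewrite le_eqVlt => /orP[/eqP <-|t0].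
  by rewrite scale0r addr0 subr0 scale1r.
move: t1; rewrite le_eqVlt => /orP[/eqP ->|t1].
  by rewrite subrr scale0r add0r scale1r.
by apply: I_add; apply: I_scale; rewrite ?subr_gt0.
Qed.

(** By the Gauss-Lucas theorem on the complex lines of direction [b]. *)
Lemma stable_on_dirD d g b : stable_on I d.+1 g -> I b ->
  stable_on I d (dirD b g).
Proof.
move=> [hg gpos gst] Ib; have hD := dirD_homog b hg.
have st y a : I a -> cev (dirD b g) (cpt y a) != 0.
  move=> Ia; pose q := gline (toC R) g (cpt y a) (fun i => toC R (b i 0)).
  have qE z : q.[z] = cev g (fun i => cpt y a i + z * toC R (b i 0)).
    exact: horner_gline.
  have -> : cev (dirD b g) (cpt y a) = q^`().[0].
    rewrite deriv_gline horner_gline.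
    by apply: cev_ext => i; rewrite mul0r addr0.
  have gb : cev g (fun i => toC R (b i 0)) != 0.
    by rewrite cev_real fmorph_eq0 gt_eqF // gpos.
  have [rs srs E] := cev_line_split (cpt y a) hg gb.
  apply: gauss_lucas0 => [|z zi].
    have -> : q = cev g (fun i => toC R (b i 0)) *: \prod_(r <- rs) ('X - r%:P).
      apply: poly_eq_neq0 => z _; rewrite qE E hornerZ horner_prod.
      by congr (_ * _); apply: eq_bigr => r _; rewrite hornerXsubC.
    by rewrite size_scale // size_prod_XsubC srs.
  rewrite qE; case: z zi => s t /=; rewrite le_eqVlt => /orP[/eqP t0|t0].
    have := gst (y + s *: b) a Ia; rewrite (_ : cev g _ =
      cev g (fun i => cpt y a i + (s +i* t)%C * toC R (b i 0))) //.
    apply: cev_ext => i; rewrite /cpt !mxE rmorphD rmorphM /= -t0 addrAC.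
    by [].
  have := gst (y + s *: b) (a + t *: b) (I_add Ia (I_scale t0 Ib)).
  rewrite (_ : cev g _ =
      cev g (fun i => cpt y a i + (s +i* t)%C * toC R (b i 0))) //.
  apply: cev_ext => i; rewrite /cpt !mxE !rmorphD !rmorphM /=.
  by rewrite (complexE (s +i* t)%C) /=; ring.
have nz c : I c -> ev (dirD b g) c != 0 by move=> Ic; exact: (cev_cpt0 hD (st 0 c Ic)).
split=> // a Ia; apply: (pos_on_convex nz Ia Ib).
by rewrite (euler _ hg) mulr_gt0 // gpos.
Qed.

Lemma stable_on_foldr d g bs : stable_on I d g -> (forall b, b \in bs -> I b) ->
  (exists d', stable_on I d' (foldr dirD g bs)) \/ foldr dirD g bs = 0.
Proof.
move=> st; elim: bs => [|b bs IH] Ib /=; first by left; exists d.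
have [|[[|d'] st']|->] := IH; first by move=> c cb; apply: Ib; rewrite inE cb orbT.
- by right; apply: dirD_homog0; case: st'.
- by left; exists d'; apply: stable_on_dirD => //; apply: Ib; rewrite inE eqxx.
- by right; rewrite linear0.
Qed.

End OpenCone.

Lemma foldr_dirD_comm v g bs :
  dirD v (foldr dirD g bs) = foldr dirD (dirD v g) bs.
Proof. by elim: bs => //= b bs <-; rewrite dirD_comm. Qed.

Section Fixed.
Context (d : nat) (p : {mpoly R[n]}) (e : 'cV[R]_n) (H : hyp d p e).
Let I := hyp_int p e.
Let L := hyp_cone p e.
Let hp : p \is d.-homog. Proof. by case: H. Qed.
Let pe : 0 < ev p e. Proof. by case: H. Qed.
Let I_add := garding_add H.
Let I_scale a (c : R) : 0 < c -> I a -> I (c *: a).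
Proof. exact: (int_scale H). Qed.

Lemma hyp_stable_on : stable_on I d p.
Proof.
split=> // [a Ia|y a Ia]; last exact: (garding_stable H).
apply: (pos_on_convex I_add I_scale _ Ia (int_dir H) pe) => c Ic.
exact: (int_neq0 Ic).
Qed.

Lemma int_pos a : I a -> 0 < ev p a.
Proof. by case: hyp_stable_on => _ h _ /h. Qed.

Lemma stable_on_hyp d' g : stable_on I d' g -> hyp d' g e.
Proof.
by case=> hg g0 gst; split=> // [|y]; [apply: g0|apply: gst]; exact: (int_dir H).
Qed.

Lemma stable_on_int d' g : stable_on I d' g -> I `<=` hyp_int g e.
Proof.
by case=> hg g0 gst x Ix s s0; rewrite gt_eqF //; apply: g0; exact: int_shift.
Qed.

(** Iterated derivatives along directions of the cone are nonnegative on it: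
    for interior directions this is positivity of stable polynomials, and
    the other directions are limits of interior ones. *)
Lemma mixed_deriv_ge0 bs y : (forall b, b \in bs -> L b) -> L y ->
  0 <= ev (foldr dirD p bs) y.
Proof.
move=> Lb Ly; rewrite -[y]addr0 -(scale0r e) -line_polyE.
apply: horner0_ge0 => t t0; rewrite line_polyE.
have Ia := cone_shift H t0 Ly; set a := y + t *: e in Ia *.
suff key bs1 : (forall b, b \in bs1 -> I b) ->
    0 <= ev (foldr dirD (foldr dirD p bs1) bs) a by exact: (key [::]).
elim: bs Lb bs1 => [|x bs IH] Lb bs1 Ib1 /=.
  have [[d' [_ g0 _]]|->] := stable_on_foldr I_add I_scale hyp_stable_on Ib1.
    exact/ltW/g0.
  by rewrite ev0.
have Lx : L x by apply: Lb; rewrite inE eqxx.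
have {}IH : forall bs1, (forall b, b \in bs1 -> I b) ->
    0 <= ev (foldr dirD (foldr dirD p bs1) bs) a.
  by apply: IH => b bin; apply: Lb; rewrite inE bin orbT.
set G := foldr dirD (foldr dirD p bs1) bs.
suff : forall s, 0 < s -> 0 <= ev (dirD x G) a + s * ev (dirD e G) a.
  move=> h; have := @horner0_ge0 R ((ev (dirD x G) a)%:P + (ev (dirD e G) a) *: 'X).
  rewrite !hornerE ?mulr0 ?addr0; apply=> s s0; rewrite !hornerE mulrC.
  exact: h.
move=> s s0; have := IH (x + s *: e :: bs1); rewrite /= -foldr_dirD_comm -/G.
rewrite dirDD dirDZ evD evZ; apply => b; rewrite inE => /orP[/eqP ->|/Ib1//].
exact: (cone_shift H).
Qed.

Lemma hyp_dirD d' : d = d'.+1 -> hyp d' (dirD e p) e.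
Proof.
move=> dE; apply: stable_on_hyp; apply: (stable_on_dirD I_add I_scale) => //.
  by rewrite -dE; exact: hyp_stable_on.
exact: (int_dir H).
Qed.

Lemma stable_on_iter k d' : d = (d' + k)%N -> stable_on I d' (iter k (dirD e) p).
Proof.
elim: k d' => [|k IH] d' dE; first by have := hyp_stable_on; rewrite {1}dE addn0.
rewrite iterS; apply: (stable_on_dirD I_add I_scale); last exact: (int_dir H).
by apply: IH; rewrite addSnnS.
Qed.

Lemma hyp_iter k d' : d = (d' + k)%N -> hyp d' (iter k (dirD e) p) e.
Proof. by move=> dE; apply: stable_on_hyp; exact: (stable_on_iter dE). Qed.

Lemma int_iter_sub k d' : d = (d' + k)%N -> I `<=` hyp_int (iter k (dirD e) p) e.
Proof. by move=> dE; apply: stable_on_int; exact: (stable_on_iter dE). Qed.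

Lemma cone_iter_sub k d' : d = (d' + k)%N ->
  L `<=` hyp_cone (iter k (dirD e) p) e.
Proof.
move=> dE x Lx; apply/(hyp_coneP (hyp_iter dE)) => s s0.
exact: int_neq0 (int_iter_sub dE (cone_shift H s0 Lx)).
Qed.

End Fixed.

Lemma ev_nondecr d p e (H : hyp d p e) g (L := hyp_cone p e) :
  (forall b y, L b -> L y -> 0 <= ev (dirD b g) y) ->
  forall a b, L a -> L b -> ev g a <= ev g (a + b).
Proof.
move=> h a b La Lb; have := @horner_nondecr R (line_poly g a b) 1 ler01.
rewrite !line_polyE scale0r addr0 scale1r; apply => t t0.
rewrite deriv_line line_polyE; apply: h => //.
by apply: (cone_add H) => //; apply: (cone_scale H) => //; exact: ltW.
Qed.

End StablePolynomials.

(** * Rank one and multiple eigenvalues *)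

Section RankOneAndMultiplicity.
Context {R : realType} {n : nat}.
Implicit Types (p g : {mpoly R[n]}) (x y v e : 'cV[R]_n).

Lemma ev_eq0_dirD g v : (forall y, ev g y = 0) -> forall y, ev (dirD v g) y = 0.
Proof.
move=> h y; have -> : ev (dirD v g) y = (line_poly g y v)^`().[0].
  by rewrite deriv_line line_polyE scale0r addr0.
rewrite (_ : line_poly g y v = 0) ?deriv0 ?horner0 //.
by apply: (@poly_eq_neq0 R) => t _; rewrite line_polyE h horner0.
Qed.

(** [p] is affine along every line of direction [x]; for [x] in the
    hyperbolicity cone this says that [x] has rank at most one. *)
Definition affine_along p x : Prop := forall y, ev (dirD x (dirD x p)) y = 0.

Lemma affine_alongE p x y t : affine_along p x ->
  ev p (y + t *: x) = ev p y + t * ev (dirD x p) y.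
Proof.
move=> h; rewrite -line_polyE; set q := line_poly p y x.
have q2 : q^`()^`() = 0.
  by apply: (@poly_eq_neq0 R) => s _; rewrite !deriv_line line_polyE h horner0.
have sq : (size q <= 2)%N.
  apply/leq_sizeP => -[|[|j]] // _.
  have := congr1 (fun q : {poly R} => q`_j) q2; rewrite !coef_deriv coef0 => /eqP.
  by rewrite !mulrn_eq0 /= => /eqP.
rewrite (horner_coef_wide _ sq) big_ord_recr big_ord1 /= expr0 mulr1 expr1 mulrC.
congr (_ + _ * _); first by rewrite coef0_line.
have -> : q`_1 = q^`()`_0 by rewrite coef_deriv.
by rewrite deriv_line coef0_line.
Qed.

Lemma affine_along_dirD p x v : affine_along p x -> affine_along (dirD v p) x.
Proof.
move=> h y; rewrite !(dirD_comm x v); exact: ev_eq0_dirD.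
Qed.

Lemma affine_along_iter k p x v :
  affine_along p x -> affine_along (iter k (dirD v) p) x.
Proof. by elim: k => //= k IH h; apply: affine_along_dirD; exact: IH. Qed.

Lemma affine_alongZ p x c : affine_along p x -> affine_along p (c *: x).
Proof.
by move=> h y; rewrite !dirDZ linearZ /= !evZ h !mulr0.
Qed.

Section Fixed.
Context (d : nat) (p : {mpoly R[n]}) (e : 'cV[R]_n) (H : hyp d p e).
Let I := hyp_int p e.
Let L := hyp_cone p e.
Let hp : p \is d.-homog. Proof. by case: H. Qed.
Let pe : 0 < ev p e. Proof. by case: H. Qed.

Lemma cone_dir : L e. Proof. exact: (int_sub H (int_dir H)). Qed.

(** A line of direction [e] is eventually interior, and a univariate polynomial
    with infinitely many roots is zero. *)
Lemma ev_eq0_int g : (forall y, I y -> ev g y = 0) -> forall y, ev g y = 0.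
Proof.
move=> h y; have [T hT] := int_absorb_large H y.
suff E : line_poly g y e = 0.
  by rewrite -[y]addr0 -(scale0r e) -line_polyE E horner0.
by apply: (@poly_eq0_ge R _ T) => t /hT /h; rewrite line_polyE.
Qed.

(** Since the second derivative along [x] is monotone and homogeneous, its
    value at the order unit [e] controls all the others. *)
Lemma affine_along_cone x : L x -> ev (dirD x (dirD x p)) e = 0 ->
  affine_along p x.
Proof.
move=> Lx ge; set g := dirD x (dirD x p) in ge.
have [d' hg] : exists d', g \is d'.-homog.
  rewrite /g; move: hp; case: (d) => [|[|d'] hp']; last first.
  - by exists d'; do 2!apply: dirD_homog.
  - by exists 0%N; rewrite (dirD_homog0 _ (dirD_homog _ hp')) dhomog0.
  - by move=> hp'; exists 0%N; rewrite (dirD_homog0 _ hp') linear0 dhomog0.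
apply: ev_eq0_int => v Iv; have [s s0 /(_ s)] := int_absorb H (- v).
rewrite lexx ltW // => /(_ isT) Iev.
have Lsv : L (s *: v) by apply: (int_sub H); exact: (int_scale H).
have gnn : 0 <= ev g (s *: v).
  by apply: (mixed_deriv_ge0 H (bs := [:: x; x])) => // b; rewrite !inE orbb => /eqP ->.
have gle : ev g (s *: v) <= ev g e.
  have -> : e = s *: v + (e + s *: - v).
    by rewrite scalerN addrCA subrr addr0.
  apply: (ev_nondecr H) => //; last exact: (int_sub H).
  move=> b y Lb Ly; apply: (mixed_deriv_ge0 H (bs := [:: b; x; x])) => // c.
  by rewrite !inE orbb => /orP[] /eqP ->.
have : ev g (s *: v) = 0 by apply/le_anti; rewrite gnn -ge gle.
rewrite (ev_homog _ _ hg) => /eqP; rewrite mulf_eq0 expf_eq0 (gt_eqF s0) andbF.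
by move/eqP.
Qed.

Lemma line_split x : exists2 rs : seq R, size rs = d &
  line_poly p x e = ev p e *: \prod_(a <- rs) ('X - a%:P).
Proof.
have pe0 : ev p e != 0 by rewrite gt_eqF.
have [rs E] := real_rooted_split (hyp_real_rooted (x := x) H).
rewrite (lead_coef_line _ hp pe0) in E; exists rs => //.
have := congr1 (fun q : {poly R} => size q) E.
by rewrite (size_line _ hp pe0) /= size_scale // size_prod_XsubC => -[].
Qed.

Lemma eigenvalues_perm x (rs : seq R) :
  line_poly p (- x) e = ev p e *: \prod_(a <- rs) ('X - a%:P) ->
  perm_eq (eigenvalues p e x) rs.
Proof.
move=> E; have pe0 : ev p e != 0 by rewrite gt_eqF.
rewrite /eigenvalues E; set q := _ *: _.
have q0 : q != 0.
  by rewrite scaler_eq0 negb_or pe0 monic_neq0 // monic_prod_XsubC.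
have mupE a : mup a q = count_mem a rs.
  by rewrite -mu_prod_XsubC /q -mul_polyC mupMr // rootC.
have rq : rootsR q =i undup rs.
  move=> a; have := roots_on_rootsR q0 a; rewrite in_itv /= => <-.
  by rewrite rootZ // root_prod_XsubC mem_undup.
have uq : uniq (rootsR q) by apply: (sorted_uniq lt_trans ltxx); exact: sorted_roots.
have pu : perm_eq (rootsR q) (undup rs) by apply: uniq_perm; rewrite ?undup_uniq.
rewrite (eq_map (g := fun a => nseq (count_mem a rs) a)); last by move=> a; rewrite mupE.
apply: perm_trans (perm_count_undup rs).
by apply: perm_flatten; exact: perm_map.
Qed.

(** If [l] is the only nonzero eigenvalue of [x], then
    [p (e + s x) = p e * (1 + l s)]. *)
Lemma rank1_affine d' x : d = d'.+2 -> L x -> hyp_rank p e x = 1%N ->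
  affine_along p x.
Proof.
move=> dE Lx rk; apply: affine_along_cone => //.
have [rs srs E] := line_split (- x).
move: rk; rewrite /hyp_rank; have /permP -> := eigenvalues_perm E.
rewrite -size_filter => sf.
have [l fl] : exists l, filter (fun a => a != 0) rs = [:: l].
  by case: filter sf => [|l []] //; exists l.
have qE t : ev p (- x + t *: e) = ev p e * (t ^+ d'.+1 * (t - l)).
  rewrite -line_polyE E hornerZ horner_prod; congr (_ * _).
  under eq_bigr do rewrite hornerXsubC.
  rewrite (bigID (fun a => a != 0)) /= -big_filter fl big_seq1 mulrC; congr (_ * _).
  rewrite (eq_bigr (fun=> t)); last by move=> a /negPn/eqP ->; rewrite subr0.
  rewrite big_const_seq iter_mulr_1; congr (_ ^+ _).
  by have := count_predC (fun a => a != 0) rs; rewrite -size_filter fl srs dE => -[].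
have lin : line_poly p e x = ev p e *: (1%:P + l *: 'X).
  apply: (@poly_eq_neq0 R) => s s0; rewrite line_polyE.
  have -> : e + s *: x = (- s) *: (- x + (- s^-1) *: e).
    by rewrite scalerDr scalerA mulrNN mulfV // scale1r scaleNr scalerN opprK addrC.
  rewrite (ev_homog _ _ hp) qE dE !(hornerZ, hornerD, hornerC, hornerX).
  set c := ev p e; rewrite mulrCA; congr (_ * _).
  have E1 : (- s) ^+ d'.+1 * (- s^-1) ^+ d'.+1 = 1.
    by rewrite -exprMn mulrNN mulfV // expr1n.
  rewrite exprS -mulrA [X in - s * X]mulrA E1 mul1r.
  by field.
have := congr1 (fun q : {poly R} => q^`()^`().[0]) lin.
rewrite !deriv_line line_polyE scale0r addr0 => ->.
by rewrite !derivZ derivD derivC add0r derivZ derivX -polyC1 derivZ derivC !scaler0 horner0.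
Qed.

(** A multiple root of the derivative of a real-rooted polynomial is a root of
    the polynomial, and by Rolle's theorem it remains the largest one if it is
    the largest root of the derivative. *)
Lemma cone_of_deriv d' x : d = d'.+1 -> hyp_cone (dirD e p) e x ->
  ev (dirD e p) x = 0 -> ev (dirD e (dirD e p)) x = 0 ->
  L x /\ ev p x = 0.
Proof.
move=> dE Lx h1 h2; have [rs srs E] := line_split x.
have HD := hyp_dirD H dE.
have q0 : ev p x = 0.
  set P := \prod_(a <- rs) ('X - a%:P) in E.
  have pe0 : ev p e != 0 by rewrite gt_eqF.
  have P0 : ev p x = ev p e * P.[0] by rewrite -hornerZ -E line_polyE scale0r addr0.
  have P1 : P^`().[0] = 0.
    apply: (mulfI pe0); rewrite -hornerZ -derivZ -E deriv_line line_polyE.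
    by rewrite scale0r addr0 h1 mulr0.
  have P2 : P^`()^`().[0] = 0.
    apply: (mulfI pe0); rewrite -hornerZ -!derivZ -E !deriv_line line_polyE.
    by rewrite scale0r addr0 h2 mulr0.
  rewrite P0; apply/eqP; rewrite mulf_eq0 (negbTE pe0) /=; apply: contraT => nz.
  have [+ _] := laguerre0 nz; rewrite -/P P1 P2 srs dE => /(_ isT).
  by rewrite mulr0 subr0 expr2 mulr0 ltxx.
split=> //; apply/(hyp_coneP H) => s s0; apply/eqP => ps.
have [|c] := @poly_rolle R 0 s (line_poly p x e) s0.
  by rewrite !line_polyE scale0r addr0 q0 ps.
rewrite in_itv /= deriv_line line_polyE => /andP[c0 _] /eqP.
by apply/negP; move/(hyp_coneP HD): Lx; apply.
Qed.

End Fixed.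

(** In terms of eigenvalues: a point of the relaxed cone at which zero is a
    multiple eigenvalue already belongs to the original cone. *)
Lemma cone_of_iter k d p e x : hyp (d.+1 + k) p e ->
  hyp_cone (iter k (dirD e) p) e x -> ev (iter k (dirD e) p) x = 0 ->
  ev (dirD e (iter k (dirD e) p)) x = 0 -> hyp_cone p e x.
Proof.
elim: k d => [|k IH] d H //=; rewrite /= => Lx h1 h2.
have H' : hyp d.+2 (iter k (dirD e) p) e.
  by apply: (hyp_iter H); rewrite addnS addSn.
have [Lx' h1'] := cone_of_deriv H' erefl Lx h1 h2.
by apply: (IH d.+1) => //; move: H; rewrite addnS addSn.
Qed.

End RankOneAndMultiplicity.

(** * Closed convex cones *)

Section OrderCones.
Context {R : realType} {n : nat}.
Implicit Types (x y z u v w e : 'cV[R]_n) (L : set 'cV[R]_n).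

(** A convex cone with an order unit [e] for which the order is Archimedean,
    that is, a closed convex cone with [e] in its interior. *)
Record order_cone e L : Prop := OrderCone {
  oc_add : forall x y, L x -> L y -> L (x + y);
  oc_scale : forall x (c : R), 0 <= c -> L x -> L (c *: x);
  oc_absorb : forall v, exists2 s : R, 0 < s & forall t, `|t| <= s -> L (e + t *: v);
  oc_arch : forall x, (forall s : R, 0 < s -> L (x + s *: e)) -> L x
}.

(** The interior of the cone, expressed without [e] so that it is visibly
    preserved by automorphisms. *)
Definition algint L x : Prop := forall v, exists2 s : R, 0 < s & L (x + s *: v).

Definition extremal L x : Prop :=
  [/\ L x, x != 0 & forall y z, L y -> L z -> y + z = x -> exists c, y = c *: x].

(** The boundary is smooth at [x] when the closure of the cone of directions
    pointing from [x] into [L] is a half space, and so contains one of any two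
    opposite directions [v] and [- v]; adding the interior direction [u]
    spares taking the closure. *)
Definition smooth L x : Prop := forall u v, algint L u ->
  (exists2 t : R, 0 < t & L (x + t *: (u + v))) \/
  (exists2 t : R, 0 < t & L (x + t *: (u - v))).

Section Fixed.
Context (e : 'cV[R]_n) (L : set 'cV[R]_n) (OC : order_cone e L).

Let L_add := oc_add OC.
Let L_scale := oc_scale OC.

Lemma oc_unit : L e.
Proof.
have [s s0 /(_ 0)] := oc_absorb OC 0.
by rewrite normr0 ltW // scale0r addr0; apply.
Qed.

Lemma oc_zero : L 0.
Proof. by rewrite -(scale0r e); apply: L_scale => //; exact: oc_unit. Qed.

Lemma algint_add u y : algint L u -> L y -> algint L (u + y).
Proof.
by move=> Iu Ly v; have [s s0 h] := Iu v; exists s => //; rewrite addrAC; exact: L_add.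
Qed.

Lemma algint_scale u (c : R) : 0 < c -> algint L u -> algint L (c *: u).
Proof.
move=> c0 Iu v; have [s s0 h] := Iu (c^-1 *: v); exists s => //.
have -> : c *: u + s *: v = c *: (u + s *: (c^-1 *: v)).
  rewrite scalerDr !scalerA; congr (_ + _ *: _).
  by rewrite mulrAC mulfV ?mul1r // gt_eqF.
by apply: L_scale => //; exact: ltW.
Qed.

Lemma algint_near u w : algint L u ->
  exists2 d : R, 0 < d & forall r, `|r| < d -> algint L (u + r *: w).
Proof.
move=> Iu.
have half v : exists2 d : R, 0 < d & forall r, 0 <= r < d -> algint L (u + r *: v).
  have [s s0 h] := Iu v; exists s => // r /andP[r0 rs].
  have -> : u + r *: v = (1 - r / s) *: u + (r / s) *: (u + s *: v).
    rewrite scalerDr addrA -scalerDl subrK scale1r scalerA.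
    by rewrite divfK // gt_eqF.
  apply: algint_add; first by apply: algint_scale; rewrite // subr_gt0 ltr_pdivrMr ?mul1r.
  by apply: L_scale => //; rewrite divr_ge0 // ltW.
have [d1 d1_0 h1] := half w; have [d2 d2_0 h2] := half (- w).
exists (Num.min d1 d2); first by rewrite lt_min d1_0.
move=> r; rewrite lt_min => /andP[r1 r2].
have [r0|r0] := leP 0 r.
  by apply: h1; rewrite r0 /=; move: r1; rewrite ger0_norm.
rewrite -[r]opprK scaleNr -scalerN; apply: h2.
by rewrite oppr_ge0 (ltW r0) /=; move: r2; rewrite ltr0_norm.
Qed.

Lemma oc_not_near u w : ~ L u ->
  exists2 d : R, 0 < d & forall r, `|r| < d -> ~ L (u + r *: w).
Proof.
move=> nLu; have [s s0 nLs] : exists2 s : R, 0 < s & ~ L (u + s *: e).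
  apply: contrapT => h; apply: nLu; apply: (oc_arch OC) => s s0.
  by apply: contrapT => h'; apply: h; exists s.
have [a a0 ha] := oc_absorb OC w; exists (s * a); first exact: mulr_gt0.
move=> r ra Lr; apply: nLs.
have -> : u + s *: e = (u + r *: w) + s *: (e + (- (r / s)) *: w).
  rewrite scalerDr scalerA mulrN mulrCA mulfV ?gt_eqF // mulr1 scaleNr.
  by rewrite addrACA subrr addr0.
apply: L_add => //; apply: L_scale; first exact: ltW.
apply: ha; rewrite normrN normrM normfV (gtr0_norm s0) ler_pdivrMr // mulrC.
exact: ltW.
Qed.

(** A segment starting in the interior leaves it through the boundary. *)
Lemma algint_segment u w : algint L u ->
  (forall t, 0 <= t <= 1 -> L (u + t *: w) -> algint L (u + t *: w)) ->
  algint L (u + w).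
Proof.
move=> Iu h.
have := @unit_interval_clopen R (fun t => algint L (u + t *: w)).
rewrite scale1r; apply.
- by rewrite scale0r addr0.
- move=> t ht /algint_near -/(_ w)[d d0 hd]; exists d => // r _ rt.
  have := hd _ rt; rewrite -addrA -scalerDl addrC [t + _]addrC subrK addrC.
  by [].
- move=> t ht nI; have nL : ~ L (u + t *: w) by move=> /(h t ht).
  have [d d0 hd] := oc_not_near w nL; exists d => // r _ rt.
  have := hd _ rt; rewrite -addrA -scalerDl [t + _]addrC subrK => nLr Ir.
  by apply: nLr; have [s s0] := Ir 0; rewrite scaler0 addr0.
Qed.

Lemma oc_closed x y (c : R) : (forall t, c < t -> L (t *: x + y)) -> L (c *: x + y).
Proof.
move=> h; apply: contrapT => nL; have [d d0 hd] := oc_not_near x nL.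
apply: (hd (d / 2)); last first.
  by rewrite addrAC -scalerDl; apply: h; rewrite ltrDl divr_gt0.
by rewrite gtr0_norm ?divr_gt0 // ltr_pdivrMr // mulr_natr mulr2n ltrDl.
Qed.

Hypothesis L_pointed : forall x, L x -> L (- x) -> x = 0.

(** The smallest face containing [x], when [L x] holds. *)
Definition face_of x : set 'cV[R]_n :=
  [set w | L w /\ exists T : R, L (T *: x - w)].

Lemma face_of_self x : L x -> face_of x x.
Proof. by move=> Lx; split=> //; exists 1; rewrite scale1r subrr; exact: oc_zero. Qed.

Lemma face_of_span x (X : seq 'cV[R]_n) w : L x ->
  (forall y, y \in X -> face_of x y) -> w \in <<X>>%VS ->
  exists T : R, L (T *: x - w).
Proof.
move=> Lx FX /(coord_span (X := in_tuple X)) ->.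
apply: (big_ind (fun w => exists T : R, L (T *: x - w))).
- by exists 0; rewrite scale0r subr0; exact: oc_zero.
- move=> a b [S hS] [T hT]; exists (S + T).
  by rewrite scalerDl opprD addrACA; exact: L_add.
move=> i _; set c := coord _ _ _.
have [Ly [T hT]] : face_of x (in_tuple X)`_i by apply: FX; exact: mem_nth.
have [c0|c0] := leP 0 c.
  by exists (c * T); rewrite -scalerA -scalerBr; exact: L_scale.
exists 0; rewrite scale0r sub0r -scaleNr; apply: L_scale => //.
by rewrite oppr_ge0 ltW.
Qed.

(** Walking from [x] against [y] as far as the cone allows ends in a face that
    is too small for its span to contain [x]. *)
Lemma face_drop x y (t : R) : L x -> x != 0 -> L y -> y != 0 -> L (t *: x - y) ->
  exists2 a : R, 0 < a & L (a *: x - y) /\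
    forall X : seq 'cV[R]_n, free X ->
      (forall w, w \in X -> face_of (a *: x - y) w) ->
      free (x :: X) /\ forall w, w \in x :: X -> face_of x w.
Proof.
move=> Lx x0 Ly y0 Lt.
have Lneg z (r : R) : L z -> z != 0 -> r <= 0 -> forall w, L w -> ~ L (r *: w - z).
  move=> Lz z0 r0 w Lw Lr; move: z0; rewrite (L_pointed Lz) ?eqxx //.
  have -> : - z = (- r) *: w + (r *: w - z) by rewrite scaleNr addrA addNr add0r.
  by apply: L_add => //; apply: L_scale => //; rewrite oppr_ge0.
pose A := [set r : R | L (r *: x - y)].
have lbA : lbound A 0.
  by move=> r Ar; rewrite leNgt; apply/negP => /ltW r0; exact: (Lneg y r Ly y0 r0 x Lx Ar).
have hA : has_inf A by split; [exists t | exists 0].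
set a := inf A.
have La : L (a *: x - y).
  apply: oc_closed => r ar; have [s As sr] : exists2 s, A s & s < r.
    have ra : 0 < r - a by rewrite subr_gt0.
    have [s As] := inf_adherent ra hA; rewrite -/a addrC subrK => sr.
    by exists s.
  have -> : r *: x - y = (r - s) *: x + (s *: x - y).
    by rewrite addrA -scalerDl subrK.
  by apply: L_add => //; apply: L_scale => //; rewrite subr_ge0 ltW.
have a0 : 0 < a by rewrite ltNge; apply/negP => ale; exact: (Lneg y a Ly y0 ale x Lx La).
exists a => //; split=> // X freeX FX.
split.
  rewrite free_cons freeX andbT; apply/negP => /(face_of_span La FX) [T hT].
  have T0 : 0 < T by rewrite ltNge; apply/negP => Tle; exact: (Lneg x T Lx x0 Tle _ La hT).
  suff : a <= a - T^-1 by rewrite lerDl oppr_ge0 leNgt invr_gt0 T0.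
  apply: (ge_inf hA.2); rewrite /A /=.
  have -> : (a - T^-1) *: x - y = T^-1 *: (T *: (a *: x - y) - x).
    rewrite scalerBr scalerA mulVf ?gt_eqF // scale1r scalerBl addrAC; congr (_ - _).
  by apply: L_scale => //; rewrite invr_ge0 ltW.
move=> w; rewrite inE => /orP[/eqP ->|/FX]; first exact: face_of_self.
case=> Lw [T hT]; split=> //; exists (Num.max T 0 * a).
have -> : (Num.max T 0 * a) *: x - w = Num.max T 0 *: y +
    ((T *: (a *: x - y) - w) + (Num.max T 0 - T) *: (a *: x - y)).
  rewrite addrAC -scalerDl [T + _]addrC subrK addrA -scalerDr.
  by rewrite [y + _]addrC subrK scalerA.
apply: L_add; first by apply: L_scale; rewrite // le_max lexx orbT.
by apply: L_add => //; apply: L_scale; rewrite // subr_ge0 le_max lexx.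
Qed.

(** Krein-Milman (Minkowski): a pointed cone is generated by its extremal
    elements; induction on the dimension of the face generated by [x]. *)
Lemma extremal_generate (P : 'cV[R]_n -> Prop) :
  P 0 -> (forall x y, P x -> P y -> P (x + y)) -> (forall x, extremal L x -> P x) ->
  forall x, L x -> P x.
Proof.
move=> P0 PD PE.
suff key k x : L x -> (forall X : seq 'cV[R]_n, free X ->
    (forall w, w \in X -> face_of x w) -> (size X <= k)%N) -> P x.
  move=> x Lx; apply: (key (\dim {: 'cV[R]_n}) x Lx) => X freeX _.
  by have /eqP <- := freeX; apply: dimvS; exact: subvf.
elim: k x => [|k IH] x Lx hk.
  have [-> //|x0] := eqVneq x 0.
  have := hk [:: x]; rewrite seq1_free x0 => /(_ isT) H.
  by have /H : forall w, w \in [:: x] -> face_of x w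
    by move=> w; rewrite inE => /eqP ->; exact: face_of_self.
have [-> //|x0] := eqVneq x 0.
have [Ex|nEx] := pselect (extremal L x); first exact: PE.
have [y [z [Ly Lz yz ny]]] : exists y z, [/\ L y, L z, y + z = x &
    forall c, y <> c *: x].
  apply: contrapT => h; apply: nEx; split=> // y z Ly Lz yz.
  apply: contrapT => ny; apply: h; exists y, z; split=> // c yc; apply: ny.
  by exists c.
have y0 : y != 0 by apply/eqP => y0; apply: (ny 0); rewrite scale0r.
have Lxy : L (1 *: x - y) by rewrite scale1r -yz addrC addKr.
have [a a0 [La ha]] := face_drop Lx x0 Ly y0 Lxy.
set u := a *: x - y in La ha.
have u0 : u != 0.
  by rewrite subr_eq0; apply/eqP => ye; apply: (ny a); rewrite ye.
have Lau : L (a *: x - u) by rewrite /u opprB addrC subrK.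
have [b b0 [Lb hb]] := face_drop Lx x0 La u0 Lau.
set v := b *: x - u in Lb hb.
have small w : L w -> (forall X : seq 'cV[R]_n, free X ->
    (forall y, y \in X -> face_of w y) ->
    free (x :: X) /\ forall y, y \in x :: X -> face_of x y) ->
    P (b^-1 *: w).
  move=> Lw hw; apply: IH; first by apply: L_scale; rewrite // invr_ge0 ltW.
  move=> X freeX FX; have [|fx Fx] := hw X freeX; last exact: hk fx Fx.
  move=> c /FX [Lc [T hT]]; split=> //; exists (T * b^-1).
  by rewrite -scalerA.
have -> : x = b^-1 *: u + b^-1 *: v.
  by rewrite -scalerDr /v addrC subrK scalerA mulVf ?scale1r // gt_eqF.
by apply: PD; apply: small.
Qed.

Lemma extremal_ray x : extremal L x -> extreme_ray L (ray x).
Proof.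
move=> [Lx x0 Ex]; split; last first.
  rewrite /cone_dim; have [h1 h2] := linear_hullP (ray x).
  have -> : linear_hull (ray x) = <[x]>%VS.
    apply/eqP; rewrite eqEsubv; apply/andP; split.
      by apply: h2 => _ [a _ <-] /=; apply: memvZ; exact: memv_line.
    by rewrite -memvE; apply: h1; exists 1; rewrite /= ?scale1r ?ler01.
  by rewrite dim_vline x0.
split.
- split; first by exists (0 *: x), 0 => /=.
  move=> _ _ a b a0 b0 [c /= c0 <-] [d /= d0 <-]; exists (a * c + b * d) => /=.
    by rewrite addr_ge0 ?mulr_ge0.
  by rewrite scalerDl !scalerA.
- by move=> _ [a /= a0 <-]; exact: L_scale.
have half y z : L y -> L z -> ray x (y + z) -> ray x y.
  move=> Ly Lz [a /= a0 ax]; move: a0; rewrite le_eqVlt => /orP[/eqP a0|a0].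
    have -> : y = 0.
      apply: L_pointed => //.
      suff -> : - y = z by [].
      by apply/eqP; rewrite eq_sym -addr_eq0 addrC -ax -a0 scale0r.
    by exists 0; rewrite /= ?scale0r.
  have ai : 0 <= a^-1 by rewrite invr_ge0 ltW.
  have [|c yc] := Ex _ _ (L_scale ai Ly) (L_scale ai Lz).
    by rewrite -scalerDr -ax scalerA mulVf ?scale1r // gt_eqF.
  have c0 : 0 <= c.
    rewrite leNgt; apply/negP => cneg; move: x0; rewrite (L_pointed Lx) ?eqxx //.
    have -> : - x = (- c)^-1 *: (a^-1 *: y).
      by rewrite yc scalerA invrN mulNr mulVf ?scaleN1r // lt_eqF.
    by apply: L_scale; [rewrite invr_ge0 oppr_ge0 ltW|exact: L_scale].
  exists (a * c); first by rewrite /= mulr_ge0 // ltW.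
  by rewrite -scalerA -yc scalerA mulfV ?scale1r // gt_eqF.
move=> y z Ly Lz yz; split; first exact: half Lz yz.
by apply: (half z y) => //; rewrite addrC.
Qed.

End Fixed.

Section Automorphisms.
Context (L : set 'cV[R]_n) (A : 'M[R]_n).
Hypothesis A_unit : A \in unitmx.
Hypothesis A_L : forall x, L (A *m x) <-> L x.

Lemma algint_aut x : algint L (A *m x) <-> algint L x.
Proof.
split=> h v.
  have [s s0] := h (A *m v); rewrite scalemxAr -mulmxDr => /A_L Ls.
  by exists s.
have [s s0 /A_L] := h (invmx A *m v); rewrite mulmxDr -scalemxAr mulKVmx // => Ls.
by exists s.
Qed.

Lemma extremal_aut x : extremal L (A *m x) -> extremal L x.
Proof.
move=> [/A_L Lx Ax0 h]; split=> // [|y z Ly Lz yz].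
  by apply: contraNneq Ax0 => ->; rewrite mulmx0.
have [|||c Ayc] := h (A *m y) (A *m z); rewrite ?A_L -?mulmxDr ?yz //.
exists c; have := congr1 (mulmx (invmx A)) Ayc.
by rewrite -scalemxAr !mulKmx.
Qed.

Lemma smooth_aut x : smooth L (A *m x) -> smooth L x.
Proof.
move=> h u v Iu.
have := h (A *m u) (A *m v); rewrite -mulmxDr -mulmxBr.
case=> [|[t t0 Lt]|[t t0 Lt]]; first exact/algint_aut.
  by left; exists t => //; apply/A_L; rewrite mulmxDr -scalemxAr.
by right; exists t => //; apply/A_L; rewrite mulmxDr -scalemxAr.
Qed.

End Automorphisms.

Lemma AutP L (A : 'M[R]_n) :
  Aut L A <-> A \in unitmx /\ forall x, L (A *m x) <-> L x.
Proof.
split=> [[Au E]|[Au h]]; split=> //.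
  move=> x; split=> [Lx|Lx]; last by rewrite -E; exists x.
  by move: Lx; rewrite -{1}E => -[y Ly /(can_inj (mulKmx Au)) <-].
apply/seteqP; split=> [_ [x Lx <-]|x Lx]; first by apply/h.
exists (invmx A *m x); last by rewrite mulKVmx.
by apply/h; rewrite mulKVmx.
Qed.

Lemma inv_aut L (A : 'M[R]_n) : A \in unitmx ->
  (forall x, L (A *m x) <-> L x) -> forall x, L (invmx A *m x) <-> L x.
Proof. by move=> Au h x; rewrite -h mulKVmx. Qed.

End OrderCones.

(** * The convex geometry of derivative relaxations *)

Section HyperbolicOrderCone.
Context {R : realType} {n : nat}.
Implicit Types (p g h : {mpoly R[n]}) (x y z u v w e f : 'cV[R]_n).

Lemma hyp_order_cone d p e : hyp d p e -> order_cone e (hyp_cone p e).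
Proof.
move=> H; split.
- exact: (cone_add H).
- by move=> x c; exact: (cone_scale H).
- move=> v; have [s s0 hs] := int_absorb H v; have [r r0 hr] := int_absorb H (- v).
  exists (Num.min s r); first by rewrite lt_min s0.
  move=> t; rewrite le_min => /andP[ts tr]; apply: (int_sub H).
  have [t0|t0] := leP 0 t; first by apply: hs; rewrite t0 -(ger0_norm t0).
  rewrite -[t]opprK scaleNr -scalerN; apply: hr.
  by rewrite oppr_ge0 ltW //= -(ltr0_norm t0).
- exact: (cone_arch H).
Qed.

Lemma hyp_intP d p e x : hyp d p e -> hyp_int p e x <-> algint (hyp_cone p e) x.
Proof.
move=> H; split=> [Ix v|h].
  have [s s0 Is] := int_open Ix; have [t t0 /(_ t)] := int_absorb H v.
  rewrite lexx ltW // => /(_ isT) It.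
  exists (s * t); first exact: mulr_gt0.
  have -> : x + (s * t) *: v = (x - s *: e) + s *: (e + t *: v).
    by rewrite scalerDr scalerA addrA subrK.
  by apply: (int_sub H); apply: (garding_add H) => //; exact: (int_scale H).
have [s s0 Ls] := h (- e).
by rewrite -(subrK (s *: e) x) -scalerN; exact: (cone_shift H).
Qed.

(** Where the polynomial has a nonzero derivative along [e], the boundary of
    the cone is a smooth hypersurface. *)
Lemma smooth_simple d h e x : hyp d.+1 h e -> hyp_cone h e x ->
  (ev h x != 0) || (ev (dirD e h) x != 0) -> smooth (hyp_cone h e) x.
Proof.
move=> H Lx nz u v /(hyp_intP _ H) Iu.
have [hx0|hx] := eqVneq (ev h x) 0; last first.
  by left; have /(hyp_intP x H) := (cone_intP H Lx).2 hx; apply.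
move: nz; rewrite hx0 eqxx /= => nz.
have HD := hyp_dirD H erefl.
have ID : hyp_int (dirD e h) e x.
  by apply/(cone_intP HD); first by exact: (cone_iter_sub H (k := 1) (esym (addn1 d))).
pose l w := ev (dirD w h) x.
have lD w w' : l (w + w') = l w + l w' by rewrite /l dirDD evD.
have lZ c w : l (c *: w) = c * l w by rewrite /l dirDZ evZ.
have lge w : hyp_cone h e w -> 0 <= l w.
  move=> Lw; apply: (mixed_deriv_ge0 H (bs := [:: w])) => // b.
  by rewrite inE => /eqP ->.
have le0 : 0 < l e by rewrite lt_def nz lge //; exact: (cone_dir H).
have lu : 0 < l u.
  have [s s0 Is] := int_open Iu.
  rewrite -(subrK (s *: e) u) lD lZ ltr_wpDl ?mulr_gt0 // lge //.
  exact: (int_sub H).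
have main w : 0 < l w -> exists2 t, 0 < t & hyp_cone h e (x + t *: w).
  move=> lw; have /(hyp_intP x HD) := ID.
  move=> /(algint_near (hyp_order_cone HD) w)[d1 d1_0 h1].
  have [||d2 d2_0 h2] := @horner_deriv0_gt0_near R (line_poly h x w).
  - by rewrite line_polyE scale0r addr0 hx0.
  - by rewrite deriv_line line_polyE scale0r addr0.
  pose t := Num.min d1 d2 / 2.
  have m0 : 0 < Num.min d1 d2 by rewrite lt_min d1_0.
  have t0 : 0 < t by rewrite divr_gt0.
  have tm : t < Num.min d1 d2 by rewrite ltr_pdivrMr // mulr_natr mulr2n ltrDl.
  move: (tm); rewrite lt_min => /andP[t1 t2].
  exists t => //; apply/(hyp_coneP H) => s s0.
  have It : hyp_int (dirD e h) e (x + t *: w).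
    by apply/(hyp_intP _ HD)/h1; rewrite gtr0_norm.
  have := @horner_incr R (line_poly h (x + t *: w) e) s s0.
  rewrite !line_polyE scale0r addr0 => hs; rewrite gt_eqF //.
  apply: lt_trans (hs _) => [|r r0].
    by rewrite -line_polyE h2 // t0.
  by rewrite deriv_line line_polyE (int_pos HD) //; apply: int_shift It; exact: ltW.
have [lv|lv] := leP 0 (l v).
  by left; apply: main; rewrite lD ltr_wpDr.
right; apply: main; rewrite lD -scaleN1r lZ mulN1r.
by rewrite ltr_wpDr // oppr_ge0 ltW.
Qed.

Section Relaxation.
Context (m k : nat) (p : {mpoly R[n]}) (e : 'cV[R]_n).
Hypothesis H : hyp (m.+3 + k) p e.
Let L := hyp_cone p e.
Let h := iter k (dirD e) p.
Let K := hyp_cone h e.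
Let Hh : hyp m.+3 h e. Proof. exact: (hyp_iter H). Qed.
Let LK : L `<=` K. Proof. exact: (cone_iter_sub H). Qed.

(** At a nonsmooth point zero is a multiple eigenvalue. *)
Lemma nonsmooth_in_cone x : K x -> ~ smooth K x -> L x.
Proof.
move=> Kx ns; have [hx dx] : ev h x = 0 /\ ev (dirD e h) x = 0.
  split; apply/eqP/negPn/negP => nz; apply: ns; apply: (smooth_simple Hh Kx).
    by rewrite nz.
  by rewrite nz orbT.
exact: (cone_of_iter H).
Qed.

(** A point of rank at most one for the derivative has zero as a multiple
    eigenvalue, the derivative having degree at least three. *)
Lemma affine_in_cone y : K y -> affine_along h y -> L y.
Proof.
move=> Ky hy; have [hh _ _] := Hh.
have E : line_poly h y e = 'X^(m.+2) * (ev h e *: 'X + (ev (dirD y h) e)%:P).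
  apply: (@poly_eq_neq0 R) => s s0.
  rewrite (line_reverse _ _ hh s0) line_polyE affine_alongE //.
  rewrite hornerM hornerXn hornerD hornerZ hornerX hornerC.
  by rewrite [in LHS]exprSr -mulrA; congr (_ * _); field.
apply: (cone_of_iter H Ky).
  by rewrite -[y]addr0 -(scale0r e) -line_polyE E hornerM hornerXn expr0n mul0r.
have -> : ev (dirD e h) y = (line_poly h y e)^`().[0].
  by rewrite deriv_line line_polyE scale0r addr0.
by rewrite E derivM hornerD 2!hornerM derivXn hornerMn !hornerXn !expr0n /= mul0rn !mul0r addr0.
Qed.

Hypothesis L_pointed : forall x, L x -> L (- x) -> x = 0.
Hypothesis L_ROG : forall x, extremal L x -> affine_along p x.

(** If [x = y + z] in the relaxed cone, the second derivative along [x] is a sum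
    of nonnegative terms, one of which is the second derivative along [y]; so
    [y] also has rank at most one and lies in the original cone. *)
Lemma extremal_relaxed x : extremal L x -> extremal K x.
Proof.
move=> Ex; have [Lx x0 split_x] := Ex; split=> //; first exact: LK.
have half y z : K y -> K z -> y + z = x -> L y.
  move=> Ky Kz yz; apply: affine_in_cone => //; apply: (affine_along_cone Hh Ky).
  have dD (v : 'cV[R]_n) (a b : {mpoly R[n]}) :
      dirD v (a + b) = dirD v a + dirD v b by exact: linearD.
  have := affine_along_iter k e (L_ROG Ex) e; rewrite -/h -yz dirDD !dirDD.
  rewrite !dD !evD.
  have nn a b : K a -> K b -> 0 <= ev (dirD a (dirD b h)) e.
    move=> Ka Kb; apply: (mixed_deriv_ge0 Hh (bs := [:: a; b])).
      by move=> c; rewrite !inE => /orP[] /eqP ->.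
    exact: (cone_dir Hh).
  have := nn _ _ Ky Ky; have := nn _ _ Ky Kz; have := nn _ _ Kz Ky.
  have := nn _ _ Kz Kz; lra.
move=> y z Ky Kz yz; apply: (split_x y z) => //; first exact: half yz.
by apply: (half z y) => //; rewrite addrC.
Qed.

(** If the relaxed cone were smooth at a rank-one [x], the quadratic form
    [Q = D_x D_e^(d-3) p] would be nonnegative everywhere; being affine along
    every extremal [z], it would be invariant under translation by [z], hence
    by [e], so that [Q e = 0]; but [Q e] is a trace of [x]. *)
Lemma extremal_not_smooth x : extremal L x -> ~ smooth K x.
Proof.
move=> Ex sm; have [Lx x0 _] := Ex.
pose T := iter m (dirD e) h; pose Q := dirD x T.
have HT : hyp 3 T e by apply: (hyp_iter Hh).
have [hT _ _] := HT; have hQ : Q \is 2.-homog by exact: dirD_homog.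
have TK y : K y -> 0 <= ev T y.
  move=> Ky; apply: (mixed_deriv_ge0 HT (bs := [::])) => //.
  exact: (cone_iter_sub Hh (k := m) (d' := 3)).
have affT z : extremal L z -> affine_along T z.
  by move=> Ez; do 2!apply: affine_along_iter; exact: L_ROG.
have Qw w t : 0 < t -> K (x + t *: w) -> 0 <= ev Q w.
  move=> t0 Kt; rewrite leNgt; apply/negP => Qneg.
  have [|r r0 hr] := @horner0_gt0_near R (- ((ev Q w)%:P + ev T w *: 'X)).
    by rewrite !hornerE; lra.
  pose s := Num.min t (r / 2); have s0 : 0 < s by rewrite lt_min t0 divr_gt0.
  have Ks : K (x + s *: w).
    have -> : x + s *: w = (1 - s / t) *: x + (s / t) *: (x + t *: w).
      by rewrite scalerDr addrA -scalerDl subrK scale1r scalerA divfK // gt_eqF.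
    apply: (cone_add Hh); apply: (cone_scale Hh) => //; last 1 first.
    - by rewrite divr_ge0 // ltW.
    - by rewrite subr_ge0 ler_pdivrMr // mul1r ge_min lexx.
    - exact: LK.
  have := TK _ Ks; have -> : x + s *: w = s *: (w + s^-1 *: x).
    by rewrite scalerDr scalerA mulfV ?gt_eqF // scale1r addrC.
  rewrite (ev_homog _ _ hT) (affine_alongE _ _ (affT x Ex)) -/Q.
  rewrite pmulr_rge0 ?exprn_gt0 // => hs.
  have hs' : 0 <= ev Q w + ev T w * s.
    have -> : ev Q w + ev T w * s = s * (ev T w + s^-1 * ev Q w).
      by field; rewrite gt_eqF.
    by rewrite mulr_ge0 // ltW.
  have := hr s; rewrite gtr0_norm //; have -> : s < r.
    by rewrite gt_min ltr_pdivrMr // mulr_natr mulr2n ltrDl r0 orbT.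
  by rewrite !hornerE => /(_ isT); lra.
have Qge v : 0 <= ev Q v.
  rewrite leNgt; apply/negP => Qneg.
  have [|r r0 hr] := @horner0_gt0_near R (- line_poly Q v e).
    by rewrite hornerN line_polyE scale0r addr0 oppr_gt0.
  have s0 : 0 < r / 2 by rewrite divr_gt0.
  have sr : r / 2 < r by rewrite ltr_pdivrMr // mulr_natr mulr2n ltrDl.
  have Is : algint K ((r / 2) *: e).
    by apply/(hyp_intP _ Hh); apply: (int_scale Hh) => //; exact: (int_dir Hh).
  have [[t t0 Kt]|[t t0 Kt]] := sm _ v Is.
    have := Qw _ _ t0 Kt; have := hr (r / 2); rewrite gtr0_norm // sr => /(_ isT).
    by rewrite hornerN line_polyE addrC; lra.
  have := Qw _ _ t0 Kt; have := hr (- (r / 2)).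
  rewrite normrN gtr0_norm // sr => /(_ isT).
  have -> : (r / 2) *: e - v = - (v + (- (r / 2)) *: e) by rewrite scaleNr opprB.
  by rewrite (ev_homogN _ hQ) expr2 mulrNN mulr1 mul1r hornerN line_polyE; lra.
have Qinv z : L z -> forall v, ev Q (v + z) = ev Q v.
  move: z; apply: (extremal_generate (hyp_order_cone H) L_pointed).
  - by move=> v; rewrite addr0.
  - by move=> y z hy hz v; rewrite addrA hz hy.
  move=> z Ez v; have affQ := affine_along_dirD x (affT z Ez).
  have lin t : 0 <= ev Q v + t * ev (dirD z Q) v by rewrite -affine_alongE.
  suff D0 : ev (dirD z Q) v = 0.
    by rewrite -[z]scale1r affine_alongE // D0 mulr0 addr0.
  apply/eqP; apply: contraT => D0.
  have := lin (- (ev Q v + 1) / ev (dirD z Q) v).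
  by rewrite divfK //; lra.
have Qe : ev Q e = 0.
  have := Qinv e (cone_dir H) 0; rewrite add0r => ->.
  by rewrite -(scale0r e) (ev_homog _ _ hQ) expr0n mul0r.
have affNx : affine_along h (- x).
  by rewrite -scaleN1r; apply: affine_alongZ; apply: affine_along_iter; exact: L_ROG.
(* By Euler's identity [Q e] is a positive multiple of [D_x h e], whose vanishing
   puts [- x] into the cone. *)
have hx : ev (dirD x h) e = 0.
  have E j : ev (dirD x (iter j (dirD e) h)) e = 0 -> (j <= m)%N ->
      ev (dirD x h) e = 0.
    elim: j => [//|j IH] /= Ej jm; apply: IH; last exact: ltnW.
    have hD : dirD x (iter j (dirD e) h) \is (m.+2 - j).-homog.
      apply: dirD_homog; apply: iter_dirD_homog.
      by have [+ _ _] := Hh; congr (_ \is _.-homog); lia.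
    have [q qE] : exists q, (m.+2 - j)%N = q.+1 by exists (m.+1 - j)%N; lia.
    move: Ej; rewrite qE in hD; rewrite dirD_comm (euler _ hD) => /eqP.
    by rewrite mulf_eq0 pnatr_eq0 => /eqP.
  by apply: (E m).
have KNx : K (- x).
  apply/(hyp_coneP Hh) => s s0; have [hh he _] := Hh.
  have -> : - x + s *: e = s *: (e + s^-1 *: - x).
    by rewrite scalerDr scalerA mulfV ?gt_eqF // scale1r addrC.
  rewrite (ev_homog _ _ hh) affine_alongE // -[- x]scaleN1r dirDZ evZ hx !mulr0 addr0.
  by rewrite mulf_neq0 ?expf_neq0 // gt_eqF.
by move/eqP: x0; apply; apply: L_pointed => //; exact: affine_in_cone.
Qed.

(** The extremal rays of the original cone are recovered from the convex
    geometry of the relaxed cone alone. *)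
Lemma extremal_nonsmoothP x : extremal L x <-> extremal K x /\ ~ smooth K x.
Proof.
split=> [Ex|[[Kx x0 h'] ns]].
  by split; [exact: extremal_relaxed|exact: extremal_not_smooth].
split=> //; first exact: nonsmooth_in_cone.
by move=> y z /LK Ky /LK Kz; exact: h'.
Qed.

Lemma relaxed_aut_cone (A : 'M[R]_n) : A \in unitmx ->
  (forall x, K (A *m x) <-> K x) -> forall x, L (A *m x) <-> L x.
Proof.
have half B : B \in unitmx -> (forall x, K (B *m x) <-> K x) ->
    forall x, L x -> L (B *m x).
  move=> Bu KB; apply: (extremal_generate (hyp_order_cone H) L_pointed).
  - by rewrite mulmx0; exact: (cone0 H).
  - by move=> x y; rewrite mulmxDr; exact: (cone_add H).
  move=> x /extremal_nonsmoothP[Ex ns]; suff : extremal L (B *m x) by case.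
  apply/extremal_nonsmoothP; split; last by move=> /(smooth_aut Bu KB).
  apply: (extremal_aut (A := invmx B)); rewrite ?unitmx_inv ?mulKmx //.
  exact: inv_aut.
move=> Au KA x; split; last exact: half.
rewrite -{2}[x](mulKmx Au); apply: half; rewrite ?unitmx_inv //.
exact: inv_aut.
Qed.

End Relaxation.
End HyperbolicOrderCone.

(** * Polynomials determined by a cone *)

Section Proportionality.
Context {R : realType} {n : nat}.
Implicit Types (x y z u v w e : 'cV[R]_n) (L K : set 'cV[R]_n).
Implicit Types (phi psi : 'cV[R]_n -> R).

(** Both functions vanish where the half line from [y] in the direction [- x]
    leaves the cone; being affine along it, they are proportional there. *)
Lemma affine_ratio e K phi psi x y (a b : R) : order_cone e K ->
  (forall u, algint K u -> 0 < phi u) -> (forall u, algint K u -> 0 < psi u) ->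
  (forall u, K u -> ~ algint K u -> phi u = 0) ->
  (forall u, K u -> ~ algint K u -> psi u = 0) ->
  K x -> algint K y ->
  (forall t, phi (y + t *: x) = phi y + t * a) ->
  (forall t, psi (y + t *: x) = psi y + t * b) ->
  a * psi y = b * phi y.
Proof.
move=> OC phi_gt0 psi_gt0 phi_eq0 psi_eq0 Kx Iy Ha Hb.
wlog lt_ba : phi psi a b phi_gt0 psi_gt0 phi_eq0 psi_eq0 Ha Hb /
    b * phi y < a * psi y.
  move=> wl; have [h|h|//] := ltgtP (b * phi y) (a * psi y).
    exact: (wl phi psi).
  by apply/esym; exact: (wl psi phi).
exfalso; have p0 := phi_gt0 y Iy; have q0 := psi_gt0 y Iy.
have b0 : 0 <= b.
  rewrite leNgt; apply/negP => bneg; pose t := - psi y / b.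
  have t0 : 0 <= t by rewrite /t mulNr -mulrN -invrN divr_ge0 ?oppr_ge0 // ltW.
  have := psi_gt0 (y + t *: x) (algint_add OC Iy (oc_scale OC t0 Kx)).
  by rewrite Hb /t divfK ?lt_eqF // subrr ltxx.
have a0 : 0 < a.
  by rewrite -(pmulr_lgt0 _ q0); apply: le_lt_trans lt_ba; rewrite mulr_ge0 // ltW.
suff : algint K (y + (- (phi y / a)) *: x).
  by move/phi_gt0; rewrite Ha mulNr divfK ?gt_eqF // subrr ltxx.
apply: (algint_segment OC Iy) => t /andP[t0 t1] Kt.
apply: contrapT => /(psi_eq0 _ Kt); rewrite scalerA Hb => E.
have : t * (b * phi y) <= 1 * (b * phi y).
  by rewrite ler_wpM2r // mulr_ge0 // ltW.
have : psi y * a = t * (b * phi y).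
  have -> : psi y * a = (psi y + t * - (phi y / a) * b) * a + t * (b * phi y).
    by field; rewrite gt_eqF.
  by rewrite E mul0r add0r.
by lra.
Qed.

(** Since [L] is generated by such directions, the factor is the same along all
    of [L]. *)
Lemma affine_proportional e L K phi psi :
  order_cone e L -> order_cone e K -> L `<=` K ->
  (forall x, L x -> L (- x) -> x = 0) ->
  (forall u, algint K u -> 0 < phi u) -> (forall u, algint K u -> 0 < psi u) ->
  (forall u, K u -> ~ algint K u -> phi u = 0) ->
  (forall u, K u -> ~ algint K u -> psi u = 0) ->
  (forall x, extremal L x -> forall y, exists a, forall t,
     phi (y + t *: x) = phi y + t * a) ->
  (forall x, extremal L x -> forall y, exists b, forall t,
     psi (y + t *: x) = psi y + t * b) ->
  forall y, algint L y -> phi y * psi e = psi y * phi e.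
Proof.
move=> OL OK LK ptd phi_gt0 psi_gt0 phi_eq0 psi_eq0 Hphi Hpsi.
have LKi y : algint L y -> algint K y.
  by move=> Iy v; have [s s0 /LK Ks] := Iy v; exists s.
have Lsub y : algint L y -> L y.
  by move=> /(_ 0)[s _]; rewrite scaler0 addr0.
have key z : L z -> L z /\ forall y, algint K y ->
    phi (y + z) * psi y = psi (y + z) * phi y.
  move: z; apply: (extremal_generate OL ptd).
  - by split=> [|y _]; [exact: (oc_zero OL)|rewrite addr0 mulrC].
  - move=> z1 z2 [L1 h1] [L2 h2]; split=> [|y Iy]; first exact: (oc_add OL).
    have Iz := algint_add OK Iy (LK _ L1).
    have p1 := phi_gt0 _ Iz; have q1 := psi_gt0 _ Iz.
    have := h2 _ Iz; have := h1 _ Iy; rewrite addrA.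
    set A := phi (y + z1 + z2); set B := psi (y + z1 + z2).
    move=> E1 E2; apply: (mulIf (lt0r_neq0 q1)).
    by rewrite mulrAC E2 -mulrA E1; ring.
  - move=> x Ex; split=> [|y Iy]; first by case: Ex.
    have [a Ha] := Hphi x Ex y; have [b Hb] := Hpsi x Ex y.
    have Kx : K x by apply: LK; case: Ex.
    have E := affine_ratio OK phi_gt0 psi_gt0 phi_eq0 psi_eq0 Kx Iy Ha Hb.
    have := Ha 1; have := Hb 1; rewrite scale1r => -> ->.
    by rewrite !mul1r !mulrDl E; ring.
have Ie : algint L e.
  move=> v; have [s s0 /(_ s)] := oc_absorb OL v.
  by rewrite gtr0_norm // lexx => /(_ isT); exists s.
move=> y Iy; have [_ /(_ y (LKi _ Iy)) E1] := key e (oc_unit OL).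
have [_ /(_ e (LKi _ Ie)) E2] := key y (Lsub _ Iy).
have pe := phi_gt0 _ (LKi _ Ie); have qe := psi_gt0 _ (LKi _ Ie).
have Iye := algint_add OK (LKi _ Iy) (LK _ (oc_unit OL)).
have pz := phi_gt0 _ Iye; have qz := psi_gt0 _ Iye.
move: E2; rewrite [e + y]addrC => E2.
apply: (mulfI (lt0r_neq0 pz)).
by rewrite mulrCA E2 mulrA [_ * psi (y + e)]mulrC -E1 mulrA.
Qed.

End Proportionality.

Section DerivativesUnderMaps.
Context {R : realType} {n : nat}.
Implicit Types (p g : {mpoly R[n]}) (x y v e f : 'cV[R]_n) (A : 'M[R]_n).

Lemma ev_dirD_map A g g' (c : R) e f : A *m f = e ->
  (forall y, ev g (A *m y) = c * ev g' y) ->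
  forall y, ev (dirD e g) (A *m y) = c * ev (dirD f g') y.
Proof.
move=> Afe h y.
have E : line_poly g (A *m y) e = c *: line_poly g' y f.
  apply: (@poly_eq_neq0 R) => t _.
  by rewrite hornerZ !line_polyE -h mulmxDr -scalemxAr Afe.
have := congr1 (fun q : {poly R} => q^`().[0]) E.
by rewrite derivZ hornerZ !deriv_line !line_polyE !scale0r !addr0.
Qed.

Lemma ev_iter_dirD_map k A g g' (c : R) e f : A *m f = e ->
  (forall y, ev g (A *m y) = c * ev g' y) ->
  forall y, ev (iter k (dirD e) g) (A *m y) = c * ev (iter k (dirD f) g') y.
Proof. by move=> Afe h; elim: k => //= k IH; exact: ev_dirD_map. Qed.

Lemma ev_iter_dirD_prop k g g' (c : R) e :
  (forall y, ev g y = c * ev g' y) ->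
  forall y, ev (iter k (dirD e) g) y = c * ev (iter k (dirD e) g') y.
Proof.
move=> h y; rewrite -{1}[y]mul1mx.
by apply: ev_iter_dirD_map => [|z]; rewrite mul1mx.
Qed.

Lemma derivn_line k p x v :
  (line_poly p x v)^`(k) = line_poly (iter k (dirD v) p) x v.
Proof. by elim: k => [//|k IH]; rewrite derivnS IH deriv_line. Qed.

Lemma ev_iter_dirD_coef k p x v :
  ev (iter k (dirD v) p) x = (line_poly p x v)`_k *+ k`!.
Proof.
by rewrite -(coef0_line _ _ v) -derivn_line coef_derivn addn0 ffactnn.
Qed.

Lemma ev_dir_deriv e k p x : ev (dir_deriv e k p) x = ev (iter k (dirD e) p) x.
Proof.
by rewrite /ev meval_dir_deriv derivn_line line_polyE scale0r addr0.
Qed.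

Lemma hyp_cone_ext p g e : (forall x, ev p x = ev g x) -> hyp_cone p e = hyp_cone g e.
Proof.
move=> h; apply/seteqP; split=> x hx t; rewrite rootE line_polyE.
  by rewrite -h -line_polyE; exact: hx.
by rewrite h -line_polyE; exact: hx.
Qed.

Lemma ev_prop_int d p e A (c1 c2 : R) g : hyp d p e ->
  (forall y, hyp_int p e y -> c1 * ev g y = c2 * ev g (A *m y)) ->
  forall y, c1 * ev g y = c2 * ev g (A *m y).
Proof.
move=> H h y; have [T hT] := int_absorb_large H y.
have E : c1 *: line_poly g y e - c2 *: line_poly g (A *m y) (A *m e) = 0.
  apply: (@poly_eq0_ge R _ T) => t /hT /h.
  by rewrite !hornerE !line_polyE mulmxDr -scalemxAr => ->; rewrite subrr.
have := congr1 (fun q : {poly R} => q.[0]) E.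
by rewrite !hornerE !line_polyE !scale0r !addr0 => /eqP; rewrite subr_eq0 => /eqP.
Qed.

End DerivativesUnderMaps.

Section DirectionOfDerivative.
Context {R : realType} {n : nat}.
Implicit Types (p g : {mpoly R[n]}) (x y v e f : 'cV[R]_n).

(** All eigenvalues of [x] for the derivative vanish, so zero is a multiple
    one. *)
Lemma cone_of_nilpotent N k p e x (c : R) : hyp (N.+2 + k) p e -> c != 0 ->
  (forall t, ev (iter k (dirD e) p) (x + t *: e) = c * t ^+ N.+2) ->
  hyp_cone p e x.
Proof.
move=> H c0 h; set g := iter k (dirD e) p in h.
have E : line_poly g x e = c *: 'X^(N.+2).
  by apply: (@poly_eq_neq0 R) => t _; rewrite line_polyE h hornerZ hornerXn.
have Hg : hyp N.+2 g e by exact: (hyp_iter H).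
apply: (cone_of_iter (k := k) (d := N.+1)) => //.
- apply/(hyp_coneP Hg) => s s0.
  by rewrite h mulf_neq0 // expf_neq0 // gt_eqF.
- by rewrite -/g -(coef0_line _ _ e) E coefZ coefXn mulr0.
- by rewrite -/g -(coef0_line _ _ e) -deriv_line E coef_deriv coefZ coefXn mulr0 mul0rn.
Qed.

Lemma coef1_prod_XsubC (rs : seq R) : (forall a, a \in rs -> a != 0) ->
  (\prod_(a <- rs) ('X - a%:P))`_1 =
  (\prod_(a <- rs) - a) * \sum_(a <- rs) (- a)^-1.
Proof.
elim: rs => [|a rs IH] h; first by rewrite !big_nil mulr0 coefC.
have a0 : a != 0 by apply: h; rewrite inE eqxx.
rewrite !big_cons mulrBl coefB coefXM coefCM /= IH; last first.
  by move=> b bin; apply: h; rewrite inE bin orbT.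
rewrite -horner_coef0 horner_prod (eq_bigr (fun a => - a)); last first.
  by move=> b _; rewrite hornerXsubC sub0r.
by field.
Qed.

(** Derivatives of the same order along two interior directions are proportional
    only if the directions are. Differentiating further along [e] reduces [p] to degree
    [k + 1]; comparing coefficients, proportionality then says that the
    eigenvalues of [f] have equal arithmetic and harmonic means. *)
Lemma iter_dirD_direction m k p e f (c : R) :
  hyp (m.+1 + k.+1) p e -> (forall x, hyp_cone p e x -> hyp_cone p e (- x) -> x = 0) ->
  hyp_int p e f -> c != 0 ->
  (forall y, ev (iter k.+1 (dirD f) p) y = c * ev (iter k.+1 (dirD e) p) y) ->
  exists2 a : R, 0 < a & f = a *: e.
Proof.
move=> H ptd If c0 h.
have dE : (m.+1 + k.+1)%N = (k.+2 + m)%N by lia.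
rewrite dE in H; set g := iter m (dirD e) p.
have Hg : hyp k.+2 g e by exact: (hyp_iter H).
have [hg ge _] := Hg.
have hgk y : ev (iter k.+1 (dirD f) g) y = c * ev (iter k.+1 (dirD e) g) y.
  have comm u : iter k.+1 (dirD u) g = iter m (dirD e) (iter k.+1 (dirD u) p).
    exact: iter_dirD_iter_comm.
  by rewrite !comm; exact: ev_iter_dirD_prop.
have [rs srs E] := line_split Hg f.
have rs_neg a : a \in rs -> a < 0.
  move=> ars; rewrite ltNge; apply/negP => a0.
  have /(int_iter_sub H erefl) Ig := If.
  have /negP[] := hyp_intE Ig a0; rewrite -line_polyE E hornerZ.
  by rewrite mulf_eq0 -rootE root_prod_XsubC ars orbT.
pose mu := [seq - a | a <- rs].
have mu_pos (t : R) : t \in mu -> 0 < t.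
  by move=> /mapP[a /rs_neg ars ->]; rewrite oppr_gt0.
have smu : size mu = k.+2 by rewrite size_map.
set S := \sum_(t <- mu) t; set S' := \sum_(t <- mu) t^-1.
pose D := \prod_(t <- mu) t.
have D0 : D != 0.
  by rewrite prodf_seq_neq0; apply/allP => t /mu_pos /gt_eqF ->.
have gf : ev g f = ev g e * D.
  rewrite -(coef0_line _ _ e) E coefZ -horner_coef0 horner_prod /D big_map.
  by congr (_ * _); apply: eq_bigr => a _; rewrite hornerXsubC sub0r.
have ck : (line_poly g f e)`_k.+1 = ev g e * S.
  rewrite E coefZ; congr (_ * _).
  have -> : k.+1 = (size rs).-1 by rewrite srs.
  rewrite coefPn_prod_XsubC ?srs // /S big_map -sumrN.
  by apply: eq_bigr => a _.
have c1 : (line_poly g e f)`_k.+1 = ev g e * (D * S').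
  rewrite (coef_line_reverse _ _ _ hg) leqnSn subSnn E coefZ; congr (_ * _).
  rewrite coef1_prod_XsubC; last by move=> a /rs_neg /lt_eqF ->.
  by rewrite /D /S' !big_map.
have diag x : (line_poly g x x)`_k.+1 = k.+2%:R * ev g x.
  rewrite (coef_line_reverse _ _ _ hg) leqnSn subSnn.
  have -> : (line_poly g x x)`_1 = (line_poly g x x)^`()`_0 by rewrite coef_deriv.
  by rewrite deriv_line coef0_line (euler _ hg).
have kf : (k.+1)`!%:R != 0 :> R by rewrite pnatr_eq0 -lt0n fact_gt0.
have coefs x : (line_poly g x f)`_k.+1 = c * (line_poly g x e)`_k.+1.
  have := hgk x; rewrite !ev_iter_dirD_coef mulrnAr => hx.
  by apply: (mulIf kf); rewrite !mulr_natr.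
have E1 := coefs f; rewrite diag gf ck in E1.
have E2 := coefs e; rewrite diag c1 in E2.
have ge0 : ev g e != 0 by rewrite gt_eqF.
have SS : S * S' = (size mu)%:R ^+ 2.
  have E1' : k.+2%:R * D = c * S.
    by apply: (mulfI ge0); rewrite mulrCA E1 mulrCA.
  have E2' : D * S' = c * k.+2%:R.
    by apply: (mulfI ge0); rewrite E2; ring.
  apply: (mulfI (mulf_neq0 c0 D0)); rewrite smu.
  have -> : c * D * (S * S') = (c * S) * (D * S') by ring.
  by rewrite -E1' E2'; ring.
have mu_eq := amhm_eq mu_pos SS; rewrite smu -/S in mu_eq.
set a := S / k.+2%:R in mu_eq.
have gline t : ev g (f + t *: e) = ev g e * (t + a) ^+ k.+2.
  rewrite -line_polyE E hornerZ horner_prod; congr (_ * _).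
  rewrite big_seq (eq_bigr (fun=> t + a)) => [|b brs]; last first.
    rewrite hornerXsubC -(mu_eq (- b)) //.
    by apply: map_f.
  by rewrite -big_seq big_const_seq count_predT iter_mulr_1 srs.
have x0 : f - a *: e = 0.
  apply: ptd.
    apply: (cone_of_nilpotent H ge0) => t.
    by rewrite -/g -scaleNr -addrA -scalerDl gline addrC addrA subrr add0r.
  apply: (cone_of_nilpotent H ge0) => t; rewrite -/g.
  have -> : - (f - a *: e) + t *: e = - (f + (- (t + a)) *: e).
    by rewrite scaleNr scalerDl !opprB addrAC [a *: e + _]addrC.
  rewrite (ev_homogN _ hg) gline mulrCA -exprMn; congr (_ * _ ^+ _); ring.
have [b brs] : exists b, b \in rs.
  by case: (rs) srs => // b rs' _; exists b; rewrite inE eqxx.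
have bmu : - b \in mu by exact: map_f.
exists a; first by rewrite -(mu_eq _ bmu) mu_pos.
by apply/eqP; rewrite -subr_eq0 x0.
Qed.

End DirectionOfDerivative.

(** * Automorphism groups *)

Section Assembly.
Context {R : realType} {n : nat}.
Implicit Types (p g : {mpoly R[n]}) (x y v e f : 'cV[R]_n) (A : 'M[R]_n).

Lemma pointed_eq0 (L : set 'cV[R]_n) x : pointed L -> L x -> L (- x) -> x = 0.
Proof.
move=> ptd Lx LNx; suff : (L `&` [set - x | x in L]) x by rewrite ptd.
by split=> //; exists (- x) => //; rewrite opprK.
Qed.

Lemma ROG_affine d p e : hyp d.+2 p e -> ROG p e ->
  forall x, extremal (hyp_cone p e) x -> affine_along p x.
Proof.
move=> H [ptd rog] x Ex.
have ptd' y := @pointed_eq0 _ y ptd.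
have [x' [Lx' rk rE]] := rog _ (extremal_ray (hyp_order_cone H) ptd' Ex).
have : ray x x by exists 1; rewrite /= ?scale1r ?ler01.
rewrite rE => -[b _ <-]; apply: affine_alongZ.
exact: (rank1_affine H erefl).
Qed.

Lemma iter_dirDZ k (r : R) v p :
  iter k (dirD (r *: v)) p = r ^+ k *: iter k (dirD v) p.
Proof.
elim: k => [|k IH]; first by rewrite expr0 scale1r.
by rewrite iterS IH dirDZ linearZ /= scalerA -exprS.
Qed.

Lemma ray_image A e (b : R) : A *m e = b *: e -> 0 < b -> mulmx A @` ray e = ray e.
Proof.
move=> Ae b0; apply/seteqP; split=> [_ [_ [a /= a0 <-] <-]|_ [a /= a0 <-]].
  by exists (a * b); rewrite /= ?mulr_ge0 ?(ltW b0) // -scalemxAr Ae scalerA.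
exists ((a / b) *: e); first by exists (a / b); rewrite //= divr_ge0 // ltW.
by rewrite -scalemxAr Ae scalerA divfK // gt_eqF.
Qed.

(** Both [g] and its composition with [A] cut out the cone of [g] and are affine
    along the extremal directions of the cone of [p], hence they are
    proportional. *)
Lemma aut_scales d d' p g e A : hyp d p e -> hyp d' g e ->
  hyp_cone p e `<=` hyp_cone g e ->
  (forall x, hyp_cone p e x -> hyp_cone p e (- x) -> x = 0) ->
  (forall x, extremal (hyp_cone p e) x -> affine_along g x) ->
  A \in unitmx ->
  (forall x, hyp_cone p e (A *m x) <-> hyp_cone p e x) ->
  (forall x, hyp_cone g e (A *m x) <-> hyp_cone g e x) ->
  exists2 c : R, c != 0 & forall y, ev g (A *m y) = c * ev g y.
Proof.
move=> Hp Hg sub ptd aff Au AL AK; set K := hyp_cone g e in AK.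
have gt0 u : algint K u -> 0 < ev g u by move=> /(hyp_intP u Hg); exact: (int_pos Hg).
have eq0 u : K u -> ~ algint K u -> ev g u = 0.
  move=> Ku nI; apply/eqP/negPn/negP => nz; apply: nI.
  exact/(hyp_intP u Hg)/(cone_intP Hg Ku).
have E := affine_proportional (hyp_order_cone Hp) (hyp_order_cone Hg) sub ptd
  (phi := ev g) (psi := fun y => ev g (A *m y)).
have {}E y : hyp_int p e y -> ev g (A *m e) * ev g y = ev g e * ev g (A *m y).
  move=> /(hyp_intP y Hp) Iy; rewrite mulrC [RHS]mulrC; apply: E => //.
  - by move=> u Iu; exact: gt0 ((algint_aut Au AK u).2 Iu).
  - move=> u Ku nI; apply: (eq0 _ ((AK u).2 Ku)) => Iu.
    exact: nI ((algint_aut Au AK u).1 Iu).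
  - by move=> x Ex z; exists (ev (dirD x g) z) => t; exact/affine_alongE/aff.
  - move=> x Ex z; exists (ev (dirD (A *m x) g) (A *m z)) => t.
    rewrite mulmxDr -scalemxAr; apply/affine_alongE/aff.
    apply: (extremal_aut (A := invmx A)); rewrite ?unitmx_inv ?mulKmx //.
    exact: inv_aut.
have {}E := ev_prop_int Hp E.
have ge : ev g e != 0 by have [_ /lt0r_neq0] := Hg.
exists (ev g (A *m e) / ev g e); last first.
  by move=> y; rewrite mulrAC E mulrAC mulfV // mul1r.
rewrite mulf_neq0 ?invr_eq0 // gt_eqF //; apply: gt0.
exact: (algint_aut Au AK e).2 ((hyp_intP e Hg).1 (int_dir Hg)).
Qed.

End Assembly.

Theorem theorem3p15 (R : realType) (n d : nat) (p : {mpoly R[n]})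
  (e : 'cV[R]_n)
  (p_homog : p \is d.-homog) (p_hyp : hyperbolic p e) (d_ge4 : (4 <= d)%N)
  (dim_ge3 : (3 <= cone_dim (hyp_cone p e))%N)
  (cone_regular : regular (hyp_cone p e)) (cone_ROG : ROG p e)
  (k : nat) (hk : (1 <= k <= d - 3)%N) :
  Aut (hyp_cone (dir_deriv e k p) e) =
  [set A | Aut (hyp_cone p e) A /\ mulmx A @` ray e = ray e].
Proof.
have [m [j [dE kE]]] : exists m j, d = (m.+3 + j.+1)%N /\ k = j.+1.
  by exists (d - 3 - k)%N, k.-1; lia.
have H := hyperbolic_hyp p_homog p_hyp; rewrite {}dE in H; subst k.
rewrite (hyp_cone_ext e (ev_dir_deriv e j.+1 p)).
set h := iter j.+1 (dirD e) p; set L := hyp_cone p e; set K := hyp_cone h e.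
have Hh : hyp m.+3 h e := hyp_iter H erefl.
have LK : L `<=` K by exact: (cone_iter_sub H erefl).
have [ptd _] := cone_regular.
have L_ptd x : L x -> L (- x) -> x = 0 by exact: pointed_eq0.
have L_aff : forall x, extremal L x -> affine_along p x by exact: (ROG_affine H).
have h_aff x : extremal L x -> affine_along h x.
  by move=> Ex; apply: affine_along_iter; exact: L_aff.
have scale_p A (Au : A \in unitmx) (AL : forall x, L (A *m x) <-> L x) :=
  aut_scales H H (@subset_refl _ _) L_ptd L_aff Au AL AL.
apply/seteqP; split=> A.
  move=> /AutP[Au AK].
  have AL := relaxed_aut_cone H L_ptd L_aff Au AK.
  split; first exact/AutP.
  have [c c0 pA] := scale_p A Au AL.
  have [c' c'0 hA] := aut_scales H Hh LK L_ptd h_aff Au AL AK.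
  pose f := invmx A *m e; have Af : A *m f = e by rewrite mulKVmx.
  have If : hyp_int p e f.
    apply: (hyp_intP f H).2; apply: (algint_aut Au AL f).1; rewrite Af.
    exact: (hyp_intP e H).1 (int_dir H).
  have prop y : ev (iter j.+1 (dirD f) p) y = (c' / c) * ev h y.
    apply: (mulfI c0); rewrite -(ev_iter_dirD_map j.+1 Af pA) hA.
    by rewrite mulrA mulrCA mulfV // mulr1.
  have [|a a0 fE] := iter_dirD_direction H L_ptd If _ prop.
    by rewrite mulf_neq0 // invr_eq0.
  apply: (@ray_image _ _ _ _ a^-1); last by rewrite invr_gt0.
  by rewrite -{2}Af fE -scalemxAr scalerA mulVf ?scale1r // gt_eqF.
move=> [/AutP[Au AL] rayA]; apply/AutP; split=> //.
have [c c0 pA] := scale_p A Au AL.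
have [b b0 Ae] : exists2 b : R, 0 < b & A *m e = b *: e.
  have : (mulmx A @` ray e) (A *m e).
    by exists e => //; exists 1; rewrite /= ?scale1r ?ler01.
  rewrite rayA => -[b /= b0 Ae]; exists b => //.
  rewrite lt_def b0 andbT; apply/eqP => bz.
  have [_ pe _] := H; have [hp _ _] := H.
  have e0 : e = 0 by rewrite -(mulKmx Au e) -Ae bz scale0r mulmx0.
  by move: pe; rewrite e0 -(scale0r e) (ev_homog _ _ hp) expr0n mul0r ltxx.
have Abe : A *m (b^-1 *: e) = e.
  by rewrite -scalemxAr Ae scalerA mulVf ?scale1r // gt_eqF.
have hA y : ev h (A *m y) = c * b^-1 ^+ j.+1 * ev h y.
  by rewrite (ev_iter_dirD_map j.+1 Abe pA) iter_dirDZ evZ mulrA.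
have c'0 : c * b^-1 ^+ j.+1 != 0.
  by rewrite mulf_neq0 // expf_neq0 // invr_eq0 gt_eqF.
move=> x; split=> /(hyp_coneP Hh) Kx; apply/(hyp_coneP Hh) => s s0.
  have := Kx (s * b) (mulr_gt0 s0 b0).
  by rewrite -scalerA -Ae scalemxAr -mulmxDr hA mulf_eq0 (negbTE c'0).
have -> : A *m x + s *: e = A *m (x + (s / b) *: e).
  by rewrite mulmxDr -scalerA -scalemxAr Abe.
by rewrite hA mulf_neq0 // Kx // divr_gt0.
Qed.
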